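(* Let $\mu$ be a Borel probability measure on $\mathbb{R}$ with mean zero, variance one and $\beta_9=\int|x|^9\,\mu(dx)<\infty$. There exists a constant $c(\mu)>0$ such that for every $\delta\in(0,1/10)$ and every $n\in\mathbb{N}$ with $n\ge c(\mu)\,\delta^{-6}$ and $\operatorname{supp}\mu\subset[-\sqrt[3]{n},\sqrt[3]{n}]$, the analytic extension of $G_{\mu_n}$ to $K$ admits the expansion, for $z\in K$ (writing $G=G_\omega(z)$), $$\begin{aligned}G_{\mu_n}(z)=\;&G+\frac{\kappa_3G^4}{(1-G^2)\sqrt n}+\left((\kappa_4-\kappa_3^2)\frac{G^5}{1-G^2}+\kappa_3^2\left(\frac{G^7}{(1-G^2)^2}+\frac{G^5}{(1-G^2)^3}\right)\right)\frac1n\\&+\left(\frac{\kappa_5G^6}{1-G^2}-\frac{\kappa_3\kappa_4G^8(5G^2-7)}{(1-G^2)^3}+\frac{\kappa_3^3G^{10}(5G^4-15G^2+12)}{(1-G^2)^5}\right)\frac1{n^{3/2}}+O\left(\frac1{n^2}\right),\end{aligned}$$ where the implied constant in $O(n^{-2})$ depends at most on $\mu$ and $\delta$ (not on $n$ or $z\in K$).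
   Context: $\mu_n$ is the distribution of $\frac1{\sqrt n}\sum_{j=1}^nX_j$, where $X_1,X_2,\dots$ are free self-adjoint identically distributed random variables with distribution $\mu$; that is, $\mu_n$ is the $n$-fold free additive convolution of the dilation of $\mu$ by the factor $1/\sqrt n$. The Cauchy transform of a probability measure $\nu$ is $G_\nu(z)=\int_{\mathbb{R}}\frac{\nu(dx)}{z-x}$, $z\in\mathbb{C}^+$. For $\delta\in(0,1/10)$, $$K=\{x+iy:\ x\in[-2+2\delta,\,2-2\delta],\ |y|<\delta\sqrt\delta\}.$$ For $n\ge c(\mu)\delta^{-6}$ (suitable $c(\mu)$), $G_{\mu_n}$ extends analytically to $K$, i.e. there is an analytic function on $K$ agreeing with $G_{\mu_n}$ on $K\cap\mathbb{C}^+$; it is again denoted $G_{\mu_n}$. $\omega$ is the standard semicircle law with density $\frac1{2\pi}\sqrt{(4-x^2)_+}$, and on $K$ one sets $G_\omega(z)=\frac12\left(z-i\sqrt{4-z^2}\right)$ with the branch of the square root positive on $(-2,2)$. The $\kappa_j$ are the free cumulants of $\mu$; with $m_k=\int x^k\mu(dx)$, $m_1=0$, $m_2=1$, they are $\kappa_3=m_3$, $\kappa_4=m_4-2$, $\kappa_5=m_5-5m_3$. *)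

(* Defs.v *)
From HB Require Import structures.
From mathcomp Require Import all_boot all_order all_algebra.
From mathcomp Require Import complex ring.
From mathcomp Require Import all_classical all_reals all_analysis.

Set Implicit Arguments.
Unset Strict Implicit.
Unset Printing Implicit Defensive.

Import Order.TTheory GRing.Theory Num.Theory.
Import numFieldNormedType.Exports.

Local Open Scope classical_set_scope.
Local Open Scope ring_scope.
Local Open Scope complex_scope.

Section Measures.
Variable R : realType.
Local Notation measure_on_line := (probability (measurableTypeR R) R).

Definition moment (nu : measure_on_line) (k : nat) : R := \int[nu]_x (x ^+ k).

Definition msupp (nu : measure_on_line) : set R :=
  [set x | forall e : R, 0 < e -> (0 < nu (ball x e))%E].

(* The complex-valued integral is taken componentwise. *)
Definition cauchy_transform (nu : measure_on_line) (z : R[i]) : R[i] :=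
  (\int[nu]_x complex.Re (z - x%:C)^-1) +i* (\int[nu]_x complex.Im (z - x%:C)^-1).

End Measures.

Section FreeCumulants.
Variable R : realType.
Implicit Type m : nat -> R.

Definition moment_poly m (n : nat) : {poly R} := \poly_(k < n.+1) m k.

(* The list of kappa_0 := 0, kappa_1, ..., kappa_n, obtained by solving for
   kappa_n the moment-cumulant relation  M(z) = 1 + sum_s kappa_s (z M(z))^s,
   i.e. R(G(z)) + 1 / G(z) = z for the R-transform R(w) = sum_s kappa_s w^(s-1);
   see [moment_free_cumulant] below. *)
Fixpoint free_cumulants m (n : nat) : seq R :=
  if n is n'.+1 then
    let ks := free_cumulants m n' in
    rcons ks (m n - \sum_(1 <= s < n) ks`_s * (moment_poly m n ^+ s)`_(n - s))
  else [:: 0].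

Definition free_cumulant m (n : nat) : R := (free_cumulants m n)`_n.

Lemma size_free_cumulants m n : size (free_cumulants m n) = n.+1.
Proof. by elim: n => //= n IH; rewrite size_rcons IH. Qed.

Lemma nth_free_cumulants m n s : (s <= n)%N ->
  (free_cumulants m n)`_s = free_cumulant m s.
Proof.
elim: n => [|n IH]; first by case: s.
rewrite leq_eqVlt => /predU1P[-> //|]; rewrite ltnS => sn.
by rewrite /= nth_rcons size_free_cumulants ltnS sn IH.
Qed.

Lemma free_cumulantS m n : free_cumulant m n.+1 =
  m n.+1 - \sum_(1 <= s < n.+1)
             free_cumulant m s * (moment_poly m n.+1 ^+ s)`_(n.+1 - s).
Proof.
rewrite {1}/free_cumulant /= nth_rcons size_free_cumulants ltnn eqxx.
congr (_ - _); apply: eq_big_nat => s /andP[_]; rewrite ltnS => sn.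
by rewrite nth_free_cumulants.
Qed.

Lemma moment_free_cumulant m n : m 0%N = 1 -> (0 < n)%N ->
  m n = \sum_(1 <= s < n.+1)
          free_cumulant m s * (moment_poly m n ^+ s)`_(n - s).
Proof.
case: n => // n m0 _; rewrite big_nat_recr//= subnn.
have -> : (moment_poly m n.+1 ^+ n.+1)`_0 = 1.
  by rewrite -horner_coef0 horner_exp horner_coef0 coef_poly m0 expr1n.
by rewrite mulr1 free_cumulantS addrC subrK.
Qed.

Section Standardized.
Variables (m : nat -> R) (m0 : m 0%N = 1) (m1 : m 1%N = 0) (m2 : m 2%N = 1).

Lemma free_cumulant1 : free_cumulant m 1 = 0.
Proof. by rewrite free_cumulantS big_geq// subr0. Qed.

Lemma free_cumulant2 : free_cumulant m 2 = 1.
Proof.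
by rewrite free_cumulantS big_nat1 free_cumulant1 mul0r subr0.
Qed.

Lemma free_cumulant3 : free_cumulant m 3 = m 3%N.
Proof.
rewrite free_cumulantS big_nat_recr// big_nat1 /= free_cumulant1 free_cumulant2.
rewrite !exprS expr0 ?mulr1 !(coefM, coef_poly, big_ord_recr, big_ord0) /=.
rewrite m0 m1 m2; ring.
Qed.

Lemma free_cumulant4 : free_cumulant m 4 = m 4%N - 2.
Proof.
rewrite free_cumulantS big_nat_recr// big_nat_recr// big_nat1 /=.
rewrite free_cumulant1 free_cumulant2 free_cumulant3.
rewrite !exprS expr0 ?mulr1 !(coefM, coef_poly, big_ord_recr, big_ord0) /=.
rewrite m0 m1 m2; ring.
Qed.

Lemma free_cumulant5 : free_cumulant m 5 = m 5%N - 5 * m 3%N.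
Proof.
rewrite free_cumulantS big_nat_recr// big_nat_recr// big_nat_recr// big_nat1 /=.
rewrite free_cumulant1 free_cumulant2 free_cumulant3 free_cumulant4.
rewrite !exprS expr0 ?mulr1 !(coefM, coef_poly, big_ord_recr, big_ord0) /=.
rewrite m0 m1 m2; ring.
Qed.

End Standardized.
End FreeCumulants.

Section FreeProbability.
Variable R : realType.
Local Notation C := R[i].

Record starProbSpace := StarProbSpace {
  carrier :> algType C;
  star : carrier -> carrier;
  state : {scalar carrier};
  starK : involutive star;
  starD : {morph star : a b / a + b};
  starZ : forall (c : C) a, star (c *: a) = c^* *: star a;
  starM : forall a b, star (a * b) = star b * star a;
  state1 : state 1 = 1;
  state_ge0 : forall a, 0 <= state (star a * a)
}.

Definition self_adjoint (A : starProbSpace) (a : A) := star a = a.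

(* Freeness of the unital subalgebras generated by the X i: alternating
   products of centred elements are centred. *)
Definition free_family (A : starProbSpace) (I : eqType) (X : I -> A) :=
  forall s : seq (I * {poly C}),
    s != [::] ->
    sorted (fun u v => u.1 != v.1) s ->
    (forall u, u \in s -> state A (horner_alg (X u.1) u.2) = 0) ->
    state A (\prod_(u <- s) horner_alg (X u.1) u.2) = 0.

(* Distribution of a (bounded) self-adjoint element; compactness of the support
   makes nu unique. *)
Definition has_distribution (A : starProbSpace) (a : A)
    (nu : probability (measurableTypeR R) R) :=
  compact (msupp nu) /\ forall k, state A (a ^+ k) = (moment nu k)%:C.

(* nu is the n-fold free additive convolution of mu dilated by 1 / sqrt n. *)
Definition normalized_free_sum_law
    (mu : probability (measurableTypeR R) R) (n : nat)
    (nu : probability (measurableTypeR R) R) :=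
  exists (A : starProbSpace) (X : nat -> A),
    [/\ forall j, self_adjoint (X j),
        forall j, has_distribution (X j) mu,
        free_family X &
        has_distribution (((Num.sqrt n%:R)^-1)%:C *: \sum_(j < n) X j) nu].

End FreeProbability.

Section Domain.
Variable R : realType.

Definition rectK (delta : R) : set R[i] :=
  [set z | -2 + 2 * delta <= complex.Re z <= 2 - 2 * delta /\
           `|complex.Im z| < delta * Num.sqrt delta].

(* [K] need not be open: holomorphic on a neighbourhood of each of its points. *)
Definition holomorphic_on (K : set R[i]) (F : R[i] -> R[i]) :=
  forall z, K z -> \forall w \near (z : R[i]^o), derivable (F : R[i]^o -> R[i]^o) w 1.

(* [sqrtc] is the principal root (nonnegative real part, see [Re_sqrtc_ge0]), so
   that it is analytic on [rectK delta], where Re (4 - z ^+ 2) > 0; by contrast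
   [sqrtC] is the root with nonnegative imaginary part. *)
Definition G_omega (z : R[i]) : R[i] := (z - 'i%C * sqrtc (4 - z ^+ 2)) / 2.

Lemma Re_sqrtc_ge0 (z : R[i]) : 0 <= complex.Re (sqrtc z).
Proof. by case: z => a b /=; exact: sqrtr_ge0. Qed.

End Domain.

(* Main.v *)
(** The proof replaces analytic continuation by an L^2 argument valid at every
    single point of the upper half-plane. Put [e = 1 / sqrt n]. Suppose that [z] and
    [Z] lie in the upper half-plane and that [w], the integral of [1 / (Z - e t)]
    against [mu(dt)], satisfies [z w = n Z w - (n - 1)]. The elements
    [e_j = w^-1 (Z - e X_j)^-1 - 1] are centred, and the sum [U] of all alternating
    words in them satisfies [w (z - e (X_1 + ... + X_n)) U = 1]. By freeness,
    alternating words are orthogonal, so the words of length [k] contribute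
    a multiple of [((n - 1) v)^k] to the squared norm, [v] being the squared norm of [e_j];
    comparing imaginary parts shows that [(n - 1) v = 1 - Im z / Im Z < 1]. Hence [U]
    converges in L^2 and [G_{mu_n}(z) = w]. In an abstract star-algebra, resolvents
    are approximated by polynomials.

    It remains to solve for [u = 1 / Z]. The equation is a perturbation of size [O(e)]
    of [1 + u^2 - z u = 0], whose root in the lower half-plane is [G_omega z], at
    distance at least of order [sqrt delta] from the other root. A contraction gives
    a root for every [z] near [K], also on or below the real axis, and the extension
    of [G_{mu_n}] is [w] as a function of [z]; divided differences show that it is
    holomorphic. Finally [w] and the asymptotic expansion satisfy the same polynomial
    equation up to [O(e^4)], and that equation is stable.

    Since [mu] has compact support, all constants may depend on a bound [L] for it. *)
Require Import Defs.
From HB Require Import structures.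
From mathcomp Require Import all_boot all_order all_algebra.
From mathcomp Require Import complex.
From mathcomp Require Import all_classical all_reals all_analysis.
From mathcomp Require Import finmap measurable_realfun ring lra.

Set Implicit Arguments.
Unset Strict Implicit.
Unset Printing Implicit Defensive.

Import Order.TTheory GRing.Theory Num.Theory.
Import numFieldNormedType.Exports.

Local Open Scope classical_set_scope.
Local Open Scope ring_scope.
Local Open Scope complex_scope.

(** * Real-valued modulus of complex numbers *)

Section ComplexModulus.
Variable R : realType.
Implicit Types (z w : R[i]) (x : R).

(** The norm of [R[i]] has values in [R[i]]; a modulus in [R] gives access to a total order and to
    linear arithmetic. *)
Definition cmod z : R := Normc.normc z.

Lemma cmodE z : `|z| = (cmod z)%:C.
Proof. by case: z. Qed.

Lemma cmod_ge0 z : 0 <= cmod z.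
Proof. by case: z => a b; exact: sqrtr_ge0. Qed.

Lemma cmodD z w : cmod (z + w) <= cmod z + cmod w.
Proof. exact: le_normcD. Qed.

Lemma cmodN z : cmod (- z) = cmod z.
Proof. exact: normcN. Qed.

Lemma cmodB z w : cmod (z - w) <= cmod z + cmod w.
Proof. by rewrite -[cmod w]cmodN cmodD. Qed.

Lemma cmodBC z w : cmod (z - w) = cmod (w - z).
Proof. by rewrite -cmodN opprB. Qed.

Lemma cmodM z w : cmod (z * w) = cmod z * cmod w.
Proof. exact: Normc.normcM. Qed.

Lemma cmodV z : cmod z^-1 = (cmod z)^-1.
Proof. exact: Normc.normcV. Qed.

Lemma cmod0 : cmod 0 = 0.
Proof. exact: Normc.normc0. Qed.

Lemma cmod1 : cmod 1 = 1.
Proof. exact: Normc.normc1. Qed.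

Lemma cmodX z n : cmod (z ^+ n) = cmod z ^+ n.
Proof. by elim: n => [|n IH]; rewrite ?expr0 ?cmod1// !exprS cmodM IH. Qed.

Lemma cmod_real x : cmod x%:C = `|x|.
Proof. by rewrite /cmod /= expr0n addr0 sqrtr_sqr. Qed.

Lemma cmod_nat n : cmod n%:R = n%:R.
Proof. by rewrite -(rmorph_nat (real_complex R)) cmod_real normr_nat. Qed.

Lemma cmod_eq0 z : (cmod z == 0) = (z == 0).
Proof.
by apply/eqP/eqP => [/Normc.eq0_normc //|->]; rewrite cmod0.
Qed.

Lemma cmod_gt0 z : (0 < cmod z) = (z != 0).
Proof. by rewrite lt_def cmod_ge0 andbT cmod_eq0. Qed.

Lemma cmod_sqr z : cmod z ^+ 2 = complex.Re z ^+ 2 + complex.Im z ^+ 2.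
Proof. by case: z => a b; rewrite /cmod sqr_sqrtr// addr_ge0 ?sqr_ge0. Qed.

Lemma normr_Re_le_cmod z : `|complex.Re z| <= cmod z.
Proof.
rewrite -(ler_pXn2r (n := 2)) ?nnegrE ?cmod_ge0 ?normr_ge0//.
by rewrite cmod_sqr real_normK ?num_real// lerDl sqr_ge0.
Qed.

Lemma normr_Im_le_cmod z : `|complex.Im z| <= cmod z.
Proof.
rewrite -(ler_pXn2r (n := 2)) ?nnegrE ?cmod_ge0 ?normr_ge0//.
by rewrite cmod_sqr real_normK ?num_real// lerDr sqr_ge0.
Qed.

Lemma cmod_le_ReIm z : cmod z <= `|complex.Re z| + `|complex.Im z|.
Proof.
rewrite -(ler_pXn2r (n := 2)) ?nnegrE ?cmod_ge0 ?addr_ge0//.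
rewrite cmod_sqr sqrrD !real_normK ?num_real// -addrA lerD2l lerDr.
by rewrite mulrn_wge0// mulr_ge0.
Qed.

Lemma cmod_ge z w : cmod z - cmod w <= cmod (z + w).
Proof. by rewrite lerBlDr -[X in cmod X <= _](addrK w) cmodB. Qed.

Lemma complexReE :
  ((forall z w, complex.Re (z + w) = complex.Re z + complex.Re w) *
   (forall z w, complex.Im (z + w) = complex.Im z + complex.Im w)) *
  ((forall z, complex.Re (- z) = - complex.Re z) *
   (forall z, complex.Im (- z) = - complex.Im z)) *
  ((forall z w, complex.Re (z * w) =
      complex.Re z * complex.Re w - complex.Im z * complex.Im w) *
   (forall z w, complex.Im (z * w) =
      complex.Re z * complex.Im w + complex.Im z * complex.Re w)).
Proof. by do !split; case=> a b //; case=> c d. Qed.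

Lemma complexReImV z : (complex.Re z^-1 = complex.Re z / cmod z ^+ 2) *
  (complex.Im z^-1 = - (complex.Im z / cmod z ^+ 2)).
Proof. by rewrite cmod_sqr; case: z. Qed.

Lemma complex_eqP z w :
  complex.Re z = complex.Re w -> complex.Im z = complex.Im w -> z = w.
Proof. by case: z w => a b [c d] /= -> ->. Qed.

End ComplexModulus.

(** * Measures with compact support *)

Section CompactSupport.
Variables (R : realType) (nu : probability (measurableTypeR R) R).

(** The form in which compact support is used: integrands need control on [[- L, L]] only. *)
Definition carried (L : R) := nu (~` `[- L, L]%classic) = 0%E.

(** Every point off the support has a null ball around it; finitely many of them cover [K]. *)
Lemma null_open_cover_compact (K : set R) : compact K -> measurable K ->
  K `<=` ~` msupp nu -> nu K = 0%E.
Proof.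
rewrite compact_cover => cK mK KS.
have null x : K x -> exists2 e : R, 0 < e & nu (ball x e) = 0%E.
  move=> /KS; rewrite /msupp /= => /existsNP[e /not_implyP[e0 /negP]].
  by rewrite lt0e measure_ge0 andbT negbK => /eqP; exists e.
(* The default radius [1] is never taken at a point of [K]. *)
pose e (x : R) := xget 1 [set e : R | 0 < e /\ nu (ball x e) = 0%E].
have eP x : K x -> 0 < e x /\ nu (ball x (e x)) = 0%E.
  by move=> /null[r r0 nr]; rewrite /e; case: xgetP => [y _ //|/(_ r)[]].
have /cK : forall i : R, K i -> open (ball i (e i)).
  by move=> i /eP[ei0 _]; exact: ball_open.
case=> [x Kx|D DK KD]; first by exists x => //; apply: ballxx; case: (eP x Kx).
apply/eqP; rewrite -measure_le0.
have := @content_sub_fsum _ _ _ nu _ [set` D] K (fun i => ball i (e i))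
  (@finite_fset _ D).
move=> /(_ _ mK KD) cK0; apply: le_trans (cK0 _) _.
  by move=> i /DK/set_mem/eP[ei0 _]; exact: measurable_ball.
rewrite fsbig1// => i iD; have /eP[_ //] : K i by apply/set_mem/DK.
Qed.

(** The complement of an interval larger than the support is covered by countably many compact
    segments that miss the support. *)
Lemma compact_msupp_carried :
  compact (msupp nu) -> exists2 L, 1 <= L & carried L.
Proof.
move=> /compact_bounded[M [_ bM]].
have {}bM x : msupp nu x -> `|x| <= `|M| + 1.
  by apply: bM; rewrite ltr_pwDr// ler_norm.
(* One more than the bound on the support, so that even the closed segments ending at [L] or [- L]
   miss it. *)
pose L := `|M| + 2; have L0 : 0 < L by rewrite ltr_wpDl.
have L1 : 1 <= L by rewrite /L; have := normr_ge0 M; lra.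
exists L => //; apply/negligibleP.
  by apply: measurableC; exact: measurable_itv.
have null a b : (0 < a) || (b < 0) -> L <= Num.min `|a| `|b| -> nu `[a, b]%classic = 0%E.
  move=> ab Lab; apply: null_open_cover_compact.
  - exact: segment_compact.
  - exact: measurable_itv.
  - move=> x /=; rewrite in_itv /= => /andP[ax xb] /bM xL.
    have : L <= `|x|.
      move: Lab; rewrite le_min => /andP[La Lb].
      case/orP: ab => [a0|b0].
        by rewrite (le_trans La)// !gtr0_norm//; exact: lt_le_trans ax.
      by rewrite (le_trans Lb)// !ltr0_norm ?lerN2//; exact: le_lt_trans xb _.
    by move=> /le_trans/(_ xL); rewrite /L; lra.
apply: (@negligibleS _ _ _ nu
  (\bigcup_(k : nat) (`[L, L + k%:R]%classic `|` `[- L - k%:R, - L]%classic))).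
  move=> x /=; rewrite in_itv /= => /negP; rewrite negb_and -!ltNge => xL.
  exists (Num.trunc (`|x|)).+1 => //=; rewrite !in_itv /=.
  have xk := truncnS_gt `|x|.
  have := ler_norm x; have := ler_norm (- x); rewrite normrN.
  by case/orP: xL => ? ? ?; [right|left]; apply/andP; split; lra.
apply: negligible_bigcup => k; apply: negligibleU; apply/negligibleP;
  try exact: measurable_itv.
- apply: null; first by rewrite L0.
  by rewrite le_min !gtr0_norm ?lerDl ?ler0n ?lexx// ltr_wpDr.
- apply: null; first by rewrite oppr_lt0 L0 orbT.
  by rewrite -opprD !normrN le_min !gtr0_norm ?lerDl ?ler0n ?lexx// ltr_wpDr.
Qed.

End CompactSupport.

(** * Real integrals against a probability measure *)

Section ProbabilityConstants.
Variables (R : realType) (nu : probability (measurableTypeR R) R).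

Lemma Rintegral_prob_cst (c : R) : \int[nu]_x c = c.
Proof. have := @Rintegral_cst _ _ _ nu setT measurableT c.
by rewrite [X in fine X](probability_setT nu) mulr1. Qed.

Lemma integrable_prob_cst (c : R) : nu.-integrable setT (EFin \o cst c).
Proof. exact: finite_measure_integrable_cst. Qed.

Lemma integrable_scale (c : R) (g : measurableTypeR R -> R) :
  nu.-integrable setT (EFin \o g) ->
  nu.-integrable setT (EFin \o (fun x => c * g x)).
Proof. exact: integrableZl. Qed.

End ProbabilityConstants.

Section RealIntegral.
Variables (R : realType) (nu : probability (measurableTypeR R) R) (L : R).
Hypothesis nuL : carried nu L.
Implicit Types f g : measurableTypeR R -> R.

Local Notation integ f := (nu.-integrable setT (EFin \o f)).

Let mN : measurable (~` `[- L, L]%classic : set (measurableTypeR R)).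
Proof. by apply: measurableC; exact: measurable_itv. Qed.

Let setTL : [set: measurableTypeR R] `\` ~` `[- L, L]%classic = `[- L, L]%classic.
Proof. by rewrite setDE setCK setTI. Qed.

Lemma carried_integrable f (C : R) : measurable_fun setT f ->
  (forall x, `|x| <= L -> `|f x| <= C) -> integ f.
Proof.
move=> mf fC; apply/(negligible_integrable mN) => //; first exact/measurable_EFinP.
rewrite setTL; apply: measurable_bounded_integrable.
- exact: measurable_itv.
- by rewrite (le_lt_trans (probability_le1 _ _)) ?ltry//; exact: measurable_itv.
- exact: measurable_funTS.
- exists C; split; first exact: num_real.
  move=> y Cy x /=; rewrite in_itv /= => xL.
  by rewrite (le_trans (fC _ _)) ?(ltW Cy)// ler_norml.
Qed.

Lemma carried_Rintegral f : integ f ->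
  \int[nu]_x f x = \int[nu]_(x in `[- L, L]) f x.
Proof.
by move=> fi; rewrite /Rintegral (negligible_integral mN)// setTL.
Qed.

Lemma carried_le_Rintegral f g : integ f -> integ g ->
  (forall x, `|x| <= L -> f x <= g x) -> \int[nu]_x f x <= \int[nu]_x g x.
Proof.
move=> fi gi fg; rewrite !carried_Rintegral//.
apply: le_Rintegral => //; try exact: measurable_itv.
- by apply: integrableS fi => //; exact: measurable_itv.
- by apply: integrableS gi => //; exact: measurable_itv.
- by move=> x /=; rewrite in_itv /= => xL; apply: fg; rewrite ler_norml.
Qed.

Lemma carried_Rintegral_bound f (C : R) : integ f ->
  (forall x, `|x| <= L -> `|f x| <= C) -> `|\int[nu]_x f x| <= C.
Proof.
move=> fi fC; rewrite (le_trans (le_normr_Rintegral _ _))//.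
rewrite -[leRHS](Rintegral_prob_cst nu) carried_le_Rintegral//.
  exact: integrable_norm.
exact: integrable_prob_cst.
Qed.

End RealIntegral.

(** * Complex integrals, taken componentwise *)

Section ComplexIntegral.
Variables (R : realType) (nu : probability (measurableTypeR R) R).
Implicit Types (f g : measurableTypeR R -> R[i]) (c : R[i]).

Definition cmeas f := measurable_fun setT (@complex.Re R \o f) /\
  measurable_fun setT (@complex.Im R \o f).

Definition cintegrable f := nu.-integrable setT (EFin \o (@complex.Re R \o f)) /\
  nu.-integrable setT (EFin \o (@complex.Im R \o f)).

Definition cint f : R[i] :=
  (\int[nu]_x complex.Re (f x)) +i* (\int[nu]_x complex.Im (f x)).

Lemma cmeas_cst c : cmeas (fun=> c).
Proof. by split; exact: measurable_cst. Qed.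

Lemma cmeas_id : cmeas (fun x : R => x%:C).
Proof. by split; [exact: measurable_id|exact: measurable_cst]. Qed.

Lemma cmeasD f g : cmeas f -> cmeas g -> cmeas (fun x => f x + g x).
Proof.
move=> [f1 f2] [g1 g2]; split;
  [rewrite (_ : _ \o _ = (@complex.Re R \o f) \+ (@complex.Re R \o g))
  |rewrite (_ : _ \o _ = (@complex.Im R \o f) \+ (@complex.Im R \o g))];
  by [exact: measurable_funD|apply/funext => x; rewrite /= !complexReE].
Qed.

Lemma cmeasM f g : cmeas f -> cmeas g -> cmeas (fun x => f x * g x).
Proof.
move=> [f1 f2] [g1 g2]; split;
 [rewrite (_ : _ \o _ = ((@complex.Re R \o f) \* (@complex.Re R \o g)) \-
    ((@complex.Im R \o f) \* (@complex.Im R \o g)))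
 |rewrite (_ : _ \o _ = ((@complex.Re R \o f) \* (@complex.Im R \o g)) \+
    ((@complex.Im R \o f) \* (@complex.Re R \o g)))];
  try (by apply/funext => x; rewrite /= !complexReE).
- by apply: measurable_funB; exact: measurable_funM.
- by apply: measurable_funD; exact: measurable_funM.
Qed.

Lemma cmeasN f : cmeas f -> cmeas (fun x => - f x).
Proof.
move=> mf; rewrite (_ : (fun x => - f x) = fun x => -1 * f x).
  exact: cmeasM (cmeas_cst _) mf.
by apply/funext => x; rewrite mulN1r.
Qed.

Lemma cmeasB f g : cmeas f -> cmeas g -> cmeas (fun x => f x - g x).
Proof. by move=> mf mg; apply: cmeasD => //; exact: cmeasN. Qed.

Lemma cmeasX f n : cmeas f -> cmeas (fun x => f x ^+ n).
Proof.
move=> mf; elim: n => [|n IH]; first exact: cmeas_cst.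
by under eq_fun do rewrite exprS; exact: cmeasM.
Qed.

Lemma cmeas_sqr f : cmeas f -> measurable_fun setT (fun x => cmod (f x) ^+ 2).
Proof.
move=> [f1 f2]; under eq_fun do rewrite cmod_sqr.
by apply: measurable_funD; exact: measurable_funX.
Qed.

Lemma cmeasV f : cmeas f -> cmeas (fun x => (f x)^-1).
Proof.
(* The real inverse is the power with exponent [-1], which is measurable; both components of the
   complex inverse are products with it. *)
move=> mf; have mi : measurable_fun setT (fun x => (cmod (f x) ^+ 2)^-1).
  under eq_fun do rewrite -powR_inv1 ?sqr_ge0//.
  exact: measurableT_comp (measurable_powR (-1)) (cmeas_sqr mf).
case: (mf) => f1 f2; split.
  rewrite (_ : _ \o _ = (@complex.Re R \o f) \* (fun x => (cmod (f x) ^+ 2)^-1)).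
    exact: measurable_funM.
  by apply/funext => x; rewrite /= complexReImV.
rewrite (_ : _ \o _ = \- ((@complex.Im R \o f) \* (fun x => (cmod (f x) ^+ 2)^-1))).
  by apply: measurable_funN; exact: measurable_funM.
by apply/funext => x; rewrite /= complexReImV.
Qed.

Lemma cmeas_horner (p : {poly R[i]}) : cmeas (fun x => p.[x%:C]).
Proof.
elim/poly_ind: p => [|p c IH].
  by under eq_fun do rewrite horner0; exact: cmeas_cst.
under eq_fun do rewrite hornerMXaddC.
by apply: cmeasD (cmeas_cst _); apply: cmeasM => //; exact: cmeas_id.
Qed.

Lemma cint_cst c : cint (fun=> c) = c.
Proof. by case: c => a b; rewrite /cint /= !Rintegral_prob_cst. Qed.

Lemma cintD f g : cintegrable f -> cintegrable g ->
  cint (fun x => f x + g x) = cint f + cint g.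
Proof.
move=> [f1 f2] [g1 g2]; apply: complex_eqP; rewrite [RHS]complexReE /=;
  rewrite -RintegralD//; by apply: eq_Rintegral => x _; rewrite complexReE.
Qed.

Lemma cintZ c f : cintegrable f -> cint (fun x => c * f x) = c * cint f.
Proof.
case: c => a b [f1 f2].
have Zi := @integrable_scale R nu.
apply: complex_eqP; rewrite [RHS]complexReE /=.
  rewrite -!RintegralZl// -RintegralB; [|exact: measurableT|exact: Zi|exact: Zi].
  by apply: eq_Rintegral => x _; rewrite complexReE.
rewrite -!RintegralZl// -RintegralD; [|exact: measurableT|exact: Zi|exact: Zi].
by apply: eq_Rintegral => x _; rewrite complexReE.
Qed.

Section Carried.
Variable L : R.
Hypothesis nuL : carried nu L.

Lemma carried_cintegrable f (C : R) : cmeas f ->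
  (forall x, `|x| <= L -> cmod (f x) <= C) -> cintegrable f.
Proof.
move=> [f1 f2] fC; split; apply: (carried_integrable nuL (C := C)) => // x /fC;
  apply: le_trans; [exact: normr_Re_le_cmod|exact: normr_Im_le_cmod].
Qed.

(** The factor [2] comes from bounding the real and imaginary parts separately. *)
Lemma carried_cint_bound f (C : R) : cmeas f ->
  (forall x, `|x| <= L -> cmod (f x) <= C) -> cmod (cint f) <= 2 * C.
Proof.
move=> mf fC; have [f1 f2] := carried_cintegrable mf fC.
rewrite (le_trans (cmod_le_ReIm _))// mulr_natl mulr2n lerD//=;
  apply: (carried_Rintegral_bound nuL) => // x /fC; apply: le_trans;
  [exact: normr_Re_le_cmod|exact: normr_Im_le_cmod].
Qed.

Lemma carried_cintB f g (C D : R) : cmeas f -> cmeas g ->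
  (forall x, `|x| <= L -> cmod (f x) <= C) ->
  (forall x, `|x| <= L -> cmod (g x) <= D) ->
  cint (fun x => f x - g x) = cint f - cint g.
Proof.
move=> mf mg fC gD; have fi := carried_cintegrable mf fC.
have gi := carried_cintegrable mg gD.
rewrite -mulN1r -cintZ// -cintD//.
  by congr cint; apply/funext => x; rewrite mulN1r.
apply: (carried_cintegrable (C := D)); first exact: cmeasM (cmeas_cst _) mg.
by move=> x /gD; rewrite mulN1r cmodN.
Qed.

Lemma carried_eq_cint f g (C : R) : cmeas f -> cmeas g ->
  (forall x, `|x| <= L -> cmod (f x) <= C) ->
  (forall x, `|x| <= L -> f x = g x) -> cint f = cint g.
Proof.
move=> mf mg fC fg; apply/eqP; rewrite -subr_eq0 -cmod_eq0 eq_le cmod_ge0 andbT.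
rewrite -(carried_cintB (C := C) (D := C))//; last by move=> x xL; rewrite -fg ?fC.
rewrite -[leRHS](mulr0 2) carried_cint_bound//; first exact: cmeasB.
by move=> x xL; rewrite fg// subrr cmod0.
Qed.

End Carried.
End ComplexIntegral.

(** * The seminorm of a state and polynomials in a self-adjoint element *)

Section StarProbability.
Variables (R : realType) (A : starProbSpace R).
Local Notation C := R[i].
Local Notation phi := (state A).
Implicit Types (a b : A) (c : C) (p q : {poly C}).

Lemma star1 : star (1 : A) = 1.
Proof. by rewrite -[LHS]mulr1 -{2}(starK (1 : A)) -starM mulr1 starK. Qed.

Lemma star0 : star (0 : A) = 0.
Proof. by apply: (addIr (star (0 : A))); rewrite -starD !add0r. Qed.

Lemma starZc c a : star (c *: a) = conjc c *: star a.
Proof. exact: starZ. Qed.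

Lemma star_sum (I : Type) (r : seq I) (P : pred I) (F : I -> A) :
  star (\sum_(i <- r | P i) F i) = \sum_(i <- r | P i) star (F i).
Proof.
by elim/big_rec2: _ => [|i x y _ <-]; rewrite ?star0// starD.
Qed.

Lemma stateD a b : phi (a + b) = phi a + phi b. Proof. exact: linearD. Qed.

Lemma stateB a b : phi (a - b) = phi a - phi b. Proof. exact: linearB. Qed.

Lemma stateZ c a : phi (c *: a) = c * phi a. Proof. exact: linearZ. Qed.

Lemma state_sum (I : Type) (r : seq I) (P : pred I) (F : I -> A) :
  phi (\sum_(i <- r | P i) F i) = \sum_(i <- r | P i) phi (F i).
Proof. exact: linear_sum. Qed.

(** Polarization: the state of [star (a + c 1) * (a + c 1)] is real for all [c], and the values
    [c = 1] and [c = i] determine the two components. *)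
Lemma state_conj a : phi (star a) = (phi a)^*.
Proof.
have realN b : complex.Im (phi (star b * b)) = 0 by apply/ger0_Im/state_ge0.
have E c : complex.Im (c * phi (star a) + c^* * phi a) = 0.
  have := realN (a + c *: 1).
  rewrite starD starZc star1 mulrDl !mulrDr -!(scalerAl, scalerAr) !mul1r mulr1.
  rewrite !(stateD, stateZ) state1 mulr1 !complexReE realN add0r.
  case: c (phi (star a)) (phi a) => [c d] [x y] [x' y'] /=; lra.
have := E 1; have := E ('i%C).
case: (phi (star a)) (phi a) => [x y] [x' y'] /= H1 H2.
by apply: complex_eqP => /=; lra.
Qed.

(** The squared GNS seminorm; the arguments work with it directly, without a completion. *)
Definition nrm2 a : R := complex.Re (phi (star a * a)).
Definition nrm a : R := Num.sqrt (nrm2 a).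

Lemma nrm2E a : phi (star a * a) = (nrm2 a)%:C.
Proof. by apply: complex_eqP => //=; apply/ger0_Im/state_ge0. Qed.

Lemma nrm2_ge0 a : 0 <= nrm2 a.
Proof. by rewrite -ler0c -nrm2E state_ge0. Qed.

Lemma nrm_ge0 a : 0 <= nrm a. Proof. exact: sqrtr_ge0. Qed.

Lemma sqr_nrm a : nrm a ^+ 2 = nrm2 a.
Proof. by rewrite sqr_sqrtr// nrm2_ge0. Qed.

Lemma state_mulC a b : phi (star b * a) = (phi (star a * b))^*.
Proof. by rewrite -state_conj starM starK. Qed.

Lemma nrm2_addZ a b c : nrm2 (a + c *: b) =
  nrm2 a + 2 * complex.Re (c * phi (star a * b)) + cmod c ^+ 2 * nrm2 b.
Proof.
rewrite /nrm2; have -> : star (a + c *: b) * (a + c *: b) = star a * a + c *: (star a * b) +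
    (conjc c *: (star b * a) + conjc c *: (c *: (star b * b))).
  by rewrite starD starZc mulrDl !mulrDr -!(scalerAl, scalerAr).
rewrite !(stateD, stateZ) (state_mulC a b) !nrm2E cmod_sqr.
case: c (phi (star a * b)) => [x y] [u v]; rewrite !complexReE /=; ring.
Qed.

Lemma state_Cauchy_Schwarz a b : cmod (phi (star a * b)) <= nrm a * nrm b.
Proof.
rewrite -(ler_pXn2r (n := 2)) ?nnegrE ?cmod_ge0 ?mulr_ge0 ?nrm_ge0//.
rewrite exprMn !sqr_nrm; set s := phi _.
(* Positivity along the line [a - t * conj(s) * b], a quadratic in the real variable [t]. *)
have E t : 0 <= nrm2 a - 2 * t * cmod s ^+ 2 + t ^+ 2 * cmod s ^+ 2 * nrm2 b.
  have := nrm2_ge0 (a + (- t%:C * conjc s) *: b); rewrite nrm2_addZ -/s.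
  rewrite cmodM cmodN cmod_real exprMn real_normK ?num_real//.
  rewrite !cmod_sqr; clearbody s; case: s => u v; rewrite !complexReE /= => H; lra.
have := nrm2_ge0 b; rewrite le_eqVlt => /predU1P[b0|b0].
  (* If [nrm2 b = 0] the inequality is linear in [t]; unless [s = 0], this [t] turns it into
     [0 <= -1]. *)
  have := E ((1 + nrm2 a) / (2 * cmod s ^+ 2)); rewrite -b0 !mulr0 addr0.
  case: (eqVneq (cmod s ^+ 2) 0) => [-> //|s0].
  rewrite (_ : 2 * ((1 + nrm2 a) / (2 * cmod s ^+ 2)) * cmod s ^+ 2 = 1 + nrm2 a).
    by rewrite opprD addrCA subrr addr0 oppr_ge0 ler10.
  by field; move: s0; rewrite sqrf_eq0.
(* The minimum of the quadratic. *)
have := E (nrm2 b)^-1.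
rewrite (_ : _ + _ = nrm2 a - cmod s ^+ 2 / nrm2 b); last by field; rewrite gt_eqF.
by rewrite subr_ge0 ler_pdivrMr.
Qed.

Lemma nrmD a b : nrm (a + b) <= nrm a + nrm b.
Proof.
rewrite -(ler_pXn2r (n := 2)) ?nnegrE ?addr_ge0 ?nrm_ge0//.
rewrite sqr_nrm -[b in X in X <= _]scale1r nrm2_addZ mul1r cmod1 expr1n !mul1r.
rewrite sqrrD !sqr_nrm lerD2r lerD2l mulr_natl.
rewrite ler_pMn2r// (le_trans _ (state_Cauchy_Schwarz a b))//.
by rewrite (le_trans (ler_norm _))// normr_Re_le_cmod.
Qed.

Lemma nrm0 : nrm 0 = 0.
Proof. by rewrite /nrm /nrm2 mulr0 linear0 sqrtr0. Qed.

Lemma nrm1 : nrm 1 = 1.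
Proof. by rewrite /nrm /nrm2 star1 mulr1 state1 sqrtr1. Qed.

Lemma nrm_sum (I : Type) (r : seq I) (P : pred I) (F : I -> A) :
  nrm (\sum_(i <- r | P i) F i) <= \sum_(i <- r | P i) nrm (F i).
Proof.
elim/big_ind2: _ => [|a x b y ax bY|//]; first by rewrite nrm0.
by rewrite (le_trans (nrmD _ _))// lerD.
Qed.

(** Pythagoras. *)
Lemma nrm2_sum_orth (I : finType) (P : pred I) (F : I -> A) :
  (forall i j, P i -> P j -> i != j -> phi (star (F i) * F j) = 0) ->
  nrm2 (\sum_(i | P i) F i) = \sum_(i | P i) nrm2 (F i).
Proof.
move=> orth; apply: complexI; rewrite -nrm2E star_sum mulr_suml state_sum.
rewrite rmorph_sum /=; apply: eq_bigr => i Pi.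
rewrite mulr_sumr state_sum (bigD1 i)//= nrm2E big1 ?addr0// => j /andP[Pj ji].
by rewrite orth// eq_sym.
Qed.

Local Notation "p ^J" := (map_poly (@conjc R) p) (at level 2).

Lemma star_horner_alg a p : self_adjoint a ->
  star (horner_alg a p) = horner_alg a p^J.
Proof.
move=> sa; elim/poly_ind: p => [|p c IH]; first by rewrite !rmorph0 star0.
rewrite !rmorphD !rmorphM /= starD starM IH map_polyX map_polyC.
rewrite !horner_algX !horner_algC sa starZc star1; congr (_ + _).
by rewrite -{1}(horner_algX a) -{4}(horner_algX a) -!rmorphM /= mulrC.
Qed.

Lemma horner_conj_real p (x : R) : (p^J).[x%:C] = (p.[x%:C])^*.
Proof. by rewrite -[in LHS](conjc_real x) horner_map. Qed.

Lemma horner_conj_mul p (x : R) : (p^J * p).[x%:C] = (cmod p.[x%:C] ^+ 2)%:C.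
Proof.
by rewrite hornerM horner_conj_real mulrC -sqr_normc cmodE rmorphXn.
Qed.

Section Distribution.
Variables (nu : probability (measurableTypeR R) R) (B : R) (a : A).
Hypotheses (nuB : carried nu B) (sa : self_adjoint a)
  (ma : forall k, phi (a ^+ k) = (moment nu k)%:C).

Lemma horner_bounded p : exists M, forall x : R, `|x| <= B -> cmod p.[x%:C] <= M.
Proof.
elim/poly_ind: p => [|p c [M IH]].
  by exists 0 => x _; rewrite horner0 cmod0.
exists (M * `|B| + cmod c) => x xB.
rewrite hornerMXaddC (le_trans (cmodD _ _))// lerD2r cmodM cmod_real.
rewrite ler_pM ?cmod_ge0 ?IH//.
by rewrite (le_trans xB)// ler_norm.
Qed.

Lemma cintegrable_horner p : cintegrable nu (fun x => p.[x%:C]).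
Proof.
have [M bM] := horner_bounded p.
exact: (carried_cintegrable nuB (cmeas_horner p) bM).
Qed.

Lemma cint_sum (I : Type) (r : seq I) (F : I -> {poly C}) :
  cint nu (fun x => (\sum_(i <- r) F i).[x%:C]) =
  \sum_(i <- r) cint nu (fun x => (F i).[x%:C]).
Proof.
elim: r => [|i r IH].
  by rewrite !big_nil; under eq_fun do rewrite horner0; rewrite cint_cst.
rewrite !big_cons -IH -cintD; try exact: cintegrable_horner.
by congr cint; apply/funext => x; rewrite hornerD.
Qed.

(** Linearity extends the identity of moments to all polynomials; this is how the law of [a]
    enters. *)
Lemma state_horner_alg p : phi (horner_alg a p) = cint nu (fun x => p.[x%:C]).
Proof.
rewrite -[p]coefK poly_def cint_sum rmorph_sum state_sum; apply: eq_bigr => i _.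
rewrite -mul_polyC rmorphM rmorphXn /= horner_algC horner_algX -scalerAl mul1r.
rewrite mul_polyC stateZ ma.
under [in RHS]eq_fun do rewrite hornerZ.
rewrite cintZ; last exact: cintegrable_horner.
congr (_ * _); apply: complex_eqP; rewrite /= ?[RHS]/=.
  rewrite /moment; apply: eq_Rintegral => x _.
  by rewrite hornerXn -rmorphXn.
rewrite -[LHS](Rintegral_prob_cst nu); apply: eq_Rintegral => x _.
by rewrite hornerXn -rmorphXn.
Qed.

Lemma nrm2_horner_alg p :
  nrm2 (horner_alg a p) = \int[nu]_x (cmod p.[x%:C] ^+ 2).
Proof.
rewrite /nrm2 star_horner_alg// -rmorphM state_horner_alg /=.
by apply: eq_Rintegral => x _; rewrite horner_conj_mul.
Qed.

(** The algebra carries no operator norm; the supremum on an interval carrying the law bounds the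
    [L^2] norm instead. *)
Lemma nrm_horner_alg_le p M :
  (forall x : R, `|x| <= B -> cmod p.[x%:C] <= M) -> 0 <= M ->
  nrm (horner_alg a p) <= M.
Proof.
move=> pM M0; rewrite -(ler_pXn2r (n := 2)) ?nnegrE ?nrm_ge0//.
rewrite sqr_nrm nrm2_horner_alg (le_trans (ler_norm _))//.
have bd (x : R) : `|x| <= B -> `|cmod p.[x%:C] ^+ 2| <= M ^+ 2.
  by move=> /pM pxM; rewrite ger0_norm ?sqr_ge0// ler_pXn2r ?nnegrE ?cmod_ge0.
apply: (carried_Rintegral_bound nuB _ bd).
exact: (carried_integrable nuB (cmeas_sqr (cmeas_horner p)) bd).
Qed.

End Distribution.
End StarProbability.

(** * Orthogonality of alternating words in free elements *)

Section FreeWords.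
Variables (R : realType) (A : starProbSpace R) (X : nat -> A).
Local Notation C := R[i].
Local Notation phi := (state A).
Local Notation "p ^J" := (map_poly (@conjc R) p) (at level 2).
Hypotheses (saX : forall j, self_adjoint (X j)) (freeX : free_family X).
Implicit Types (a b : A) (p q : {poly C}) (i j : nat) (s u v : seq (nat * {poly C})).

Local Notation ev i p := (horner_alg (X i) p).

Definition word s : A := \prod_(l <- s) ev l.1 l.2.

Definition alternating s := sorted (fun k l => k.1 != l.1) s.

Definition centred s := forall l, l \in s -> phi (ev l.1 l.2) = 0.

Definition avoids i s := if s is l :: _ then l.1 != i else true.

Definition reduced i s := [/\ alternating s, centred s & avoids i s].

Lemma word_cons l s : word (l :: s) = ev l.1 l.2 * word s.
Proof. exact: big_cons. Qed.

Lemma reduced_cons i j p s : reduced i s -> phi (ev i p) = 0 -> i != j ->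
  reduced j ((i, p) :: s).
Proof.
move=> [alt cen av] p0 ij; split => //.
- by case: s alt av {cen} => //= l s alt; rewrite eq_sym => ->.
- by move=> l; rewrite inE => /predU1P[->//|]; exact: cen.
Qed.

(** The star reverses a word; [catrev] moves its conjugated letters one at a time in front of
    [v]. *)
Lemma star_word_mul s v : star (word s) * word v =
  word (catrev [seq (l.1, l.2^J) | l <- s] v).
Proof.
elim: s v => [|l s IH] v; first by rewrite /word big_nil star1 mul1r.
by rewrite word_cons starM star_horner_alg// -mulrA -(word_cons (l.1, _)) IH.
Qed.

(** Since [s] does not begin with the index of [l], the reversed [s] followed by [l :: v] is again
    alternating and centred, and freeness applies. The induction transfers the head of [s] to the
    right-hand word. *)
Lemma star_word_orth s v l : alternating s -> centred s -> reduced l.1 v ->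
  avoids l.1 s -> phi (ev l.1 l.2) = 0 ->
  phi (star (word s) * word (l :: v)) = 0.
Proof.
move=> sa sc rv av l0; rewrite star_word_mul.
(* Any index other than [l.1] serves as witness. *)
have [k []] : exists k, reduced k (l :: v).
  by exists l.1.+1; case: l {av} rv l0 => i p rv l0; apply: reduced_cons => //; rewrite neq_ltn ltnSn.
move=> alt cen _ {rv l0 k}.
elim: s l v sa sc av alt cen => [|m s IH] l v sa sc av alt cen /=.
  exact: freeX.
apply: IH => //=.
- by move: sa; case: (s) => //= ? ? /andP[].
- by move=> x xs; apply: sc; rewrite inE xs orbT.
- by move: sa; rewrite /alternating /=; case: (s) => //= ? ? /andP[]; rewrite eq_sym.
- by apply/andP; split.
- move=> x; rewrite inE => /predU1P[->/=|]; last exact: cen.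
  have := sc m (mem_head _ _); rewrite -star_horner_alg// state_conj => ->.
  by rewrite conjc0.
Qed.

(** Elements that a centred letter of index [i] can multiply from the left with all words staying
    alternating. *)
Definition wspan i a := exists2 ws : seq (seq (nat * {poly C})),
  (forall s, s \in ws -> reduced i s) & a = \sum_(s <- ws) word s.

Lemma wspan0 i : wspan i 0.
Proof. by exists [::] => //; rewrite big_nil. Qed.

Lemma wspan1 i : wspan i 1.
Proof.
exists [:: [::]]; last by rewrite big_seq1 /word big_nil.
by move=> s; rewrite inE => /eqP ->; split.
Qed.

Lemma wspanD i a b : wspan i a -> wspan i b -> wspan i (a + b).
Proof.
move=> [u ru ->] [v rv ->]; exists (u ++ v); last by rewrite big_cat.
by move=> s; rewrite mem_cat => /orP[/ru|/rv].
Qed.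

Lemma wspan_sum i (I : Type) (r : seq I) (P : pred I) (F : I -> A) :
  (forall k, P k -> wspan i (F k)) -> wspan i (\sum_(k <- r | P k) F k).
Proof.
by move=> H; apply: big_ind => //; [exact: wspan0|move=> a b; exact: wspanD].
Qed.

Lemma wspan_mul i j p a : wspan i a -> phi (ev i p) = 0 -> i != j ->
  wspan j (ev i p * a).
Proof.
move=> [u ru ->] p0 ij; exists [seq (i, p) :: s | s <- u].
  by move=> s /mapP[t /ru rt ->]; exact: reduced_cons.
by rewrite big_map mulr_sumr; apply: eq_bigr => s _; rewrite word_cons.
Qed.

Lemma state_wspan_centred i p a b : wspan i a -> wspan i b ->
  phi (ev i p) = 0 -> phi (star a * (ev i p * b)) = 0.
Proof.
move=> [u ru ->] [v rv ->] p0; rewrite star_sum mulr_suml state_sum.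
rewrite big_seq big1// => s /ru[sa sc sav].
rewrite !mulr_sumr state_sum big_seq big1// => t /rv rt.
by rewrite -(word_cons (i, p)) star_word_orth.
Qed.

(** Split [p] into its centred part, which contributes nothing, and the constant [phi (ev i p)]. *)
Lemma state_wspan i p a b : wspan i a -> wspan i b ->
  phi (star a * (ev i p * b)) = phi (ev i p) * phi (star a * b).
Proof.
move=> ra rb; rewrite -{1}[p](subrK (phi (ev i p))%:P) rmorphD /= horner_algC.
rewrite mulrDl mulrDr stateD state_wspan_centred// ?add0r.
  by rewrite -scalerAl mul1r -scalerAr stateZ.
by rewrite rmorphB /= horner_algC stateB stateZ state1 mulr1 subrr.
Qed.

Lemma state_wspan_orth i j p q a b : wspan i a -> wspan j b ->
  phi (ev i p) = 0 -> phi (ev j q) = 0 -> i != j ->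
  phi (star (ev i p * a) * (ev j q * b)) = 0.
Proof.
by move=> ra rb p0 q0 ij; apply: state_wspan_centred => //; exact: wspan_mul.
Qed.

Lemma state_wspan_mul i p a : wspan i a -> phi (ev i p) = 0 ->
  phi (ev i p * a) = 0.
Proof.
move=> ra p0; have := state_wspan_centred (wspan1 i) ra p0.
by rewrite star1 mul1r.
Qed.

(** The factorization applied to [p^J * p]. This multiplicativity takes the place of operator norm
    bounds. *)
Lemma nrm2_wspan i p a : wspan i a -> nrm2 (ev i p * a) = nrm2 (ev i p) * nrm2 a.
Proof.
move=> ra; apply: complexI.
rewrite rmorphM /= -!nrm2E starM -mulrA [X in star a * X]mulrA.
by rewrite star_horner_alg// -rmorphM /= state_wspan.
Qed.

Lemma nrm_wspan i p a : wspan i a -> nrm (ev i p * a) = nrm (ev i p) * nrm a.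
Proof. by move=> ra; rewrite /nrm nrm2_wspan// sqrtrM// nrm2_ge0. Qed.

Section AlternatingSums.
Variables (n : nat) (q : {poly C}).
Hypothesis q0 : forall i, phi (ev i q) = 0.

(* The sum of all alternating words of length [k] in the elements [q(X_j)],
   [j < n], that do not start with [q(X_i)]. *)
Fixpoint altsum k i : A :=
  if k is k'.+1 then \sum_(j < n | (j : nat) != i) ev j q * altsum k' j else 1.

Lemma wspan_altsum k i : wspan i (altsum k i).
Proof.
elim: k i => [|k IH] i /=; first exact: wspan1.
by apply: wspan_sum => j ji; apply: wspan_mul.
Qed.

(** Each further letter is one of the [n - 1] indices other than [i]; the summands are orthogonal,
    and each multiplies the squared norm by [alpha]. *)
Lemma nrm2_altsum alpha k i : (i < n)%N -> (forall j, nrm2 (ev j q) = alpha) ->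
  nrm2 (altsum k i) = (n.-1%:R * alpha) ^+ k.
Proof.
move=> iltn qa; elim: k i iltn => [|k IH] i iltn /=.
  by rewrite -sqr_nrm nrm1 !expr1n expr0.
rewrite nrm2_sum_orth => [|j j' _ _ jj']; last first.
  by apply: state_wspan_orth => //; exact: wspan_altsum.
rewrite (eq_bigr (fun=> alpha * (n.-1%:R * alpha) ^+ k)); last first.
  by move=> j _; rewrite nrm2_wspan ?IH ?qa//; exact: wspan_altsum.
rewrite (eq_bigl (predC1 (Ordinal iltn)))// sumr_const cardC1 card_ord.
by rewrite exprS -[LHS]mulr_natl mulrA.
Qed.

End AlternatingSums.
End FreeWords.

(** * Geometric bounds and polynomial approximation of resolvents *)

Section PowerBound.
Variable R : realType.

Lemma exists_expr_le (r eta : R) : 0 <= r -> r < 1 -> 0 < eta ->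
  exists N, r ^+ N <= eta.
Proof.
move=> r0 r1 eta0; have : `|r| < 1 by rewrite ger0_norm.
move=> /cvg_expr /cvgr0Pnorm_lt /(_ _ eta0)[N _ /(_ N (leqnn N)) /=].
by rewrite ger0_norm ?exprn_ge0// => /ltW; exists N.
Qed.

Lemma sum_expr_le (r : R) N : 0 <= r -> r < 1 ->
  \sum_(k < N) r ^+ k <= (1 - r)^-1.
Proof.
move=> r0 r1; have d0 : 0 < 1 - r by rewrite subr_gt0.
rewrite -[leRHS]mul1r ler_pdivlMr// mulrC.
have -> : (1 - r) * \sum_(k < N) r ^+ k = 1 - r ^+ N.
  by rewrite -[1 - r]opprB mulNr -subrX1 opprB.
by rewrite lerBlDr lerDl exprn_ge0.
Qed.

(** Replaces the passage to the limit [eta -> 0] in an error estimate. *)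
Lemma le0_of_le_mul (x C eta0 : R) : 0 < eta0 ->
  (forall eta, 0 < eta -> eta <= eta0 -> x <= C * eta) -> x <= 0.
Proof.
move=> e0 H; rewrite leNgt; apply/negP => x0.
pose K := `|C| + 1; have K0 : 0 < K by rewrite ltr_pwDr.
pose eta := Num.min eta0 (x / (2 * K)).
have eta_gt0 : 0 < eta by rewrite lt_min e0 divr_gt0// mulr_gt0.
have := H eta eta_gt0; rewrite ge_min lexx => /(_ isT).
apply/negP; rewrite -ltNge (@le_lt_trans _ _ (K * eta))//.
  by rewrite ler_pM2r// (le_trans (ler_norm _))// lerDl.
rewrite (@le_lt_trans _ _ (K * (x / (2 * K))))//.
  by rewrite ler_pM2l// ge_min lexx orbT.
rewrite (_ : K * _ = x / 2); last by field; rewrite gt_eqF.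
by rewrite ltr_pdivrMr// ltr_pMr// ltr1n.
Qed.

(* On a bounded interval, [1 - c (z - x)] is contracting for [c = - i s] with
   [s > 0] small, so [1 / (z - x)] is the sum of a geometric series. *)
Lemma resolvent_approx (B eta : R) (z : R[i]) : 0 < complex.Im z -> 0 < eta ->
  exists P : {poly R[i]}, forall x : R, `|x| <= B ->
    cmod (1 - (z - x%:C) * P.[x%:C]) <= eta.
Proof.
move=> y0 eta0; set y := complex.Im z in y0.
pose M := `|complex.Re z| + `|B|; pose K := y ^+ 2 + M ^+ 2.
have K0 : 0 < K by rewrite ltr_pwDl ?exprn_gt0 ?sqr_ge0.
(* This [s] minimizes [1 - 2 * s * y + s ^+ 2 * K], and [r] is the minimum. *)
pose s := y / K; pose c : R[i] := 0 -i* s; pose r := 1 - y ^+ 2 / K.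
have r1 : r < 1 by rewrite ltrBlDr ltrDl divr_gt0// exprn_gt0.
have r0 : 0 <= r by rewrite subr_ge0 ler_pdivrMr// mul1r lerDl sqr_ge0.
have contr x : `|x| <= B -> cmod (1 - c * (z - x%:C)) ^+ 2 <= r.
  move=> xB; have : `|complex.Re z - x| <= M.
    by rewrite (le_trans (ler_normB _ _))// lerD2l (le_trans xB)// ler_norm.
  move=> /(lerXn2r 2); rewrite !nnegrE normr_ge0 addr_ge0// => /(_ isT isT).
  rewrite real_normK ?num_real// => xM.
  rewrite cmod_sqr.
  have [-> ->] : complex.Re (1 - c * (z - x%:C)) = 1 - s * y /\
      complex.Im (1 - c * (z - x%:C)) = s * (complex.Re z - x).
    by rewrite /y /c; case: (z) => a b; split=> /=; ring.
  rewrite (_ : (1 - s * y) ^+ 2 + (s * (complex.Re z - x)) ^+ 2 = 1 - 2 * s * y + s ^+ 2 * (y ^+ 2 + (complex.Re z - x) ^+ 2));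
    last by ring.
  apply: (@le_trans _ _ (1 - 2 * s * y + s ^+ 2 * K)).
    by rewrite lerD2l ler_wpM2l ?sqr_ge0// lerD2l.
  by rewrite /s /r le_eqVlt; apply/orP; left; apply/eqP; field; rewrite gt_eqF.
(* [contr] bounds the square of the modulus, hence the target [eta ^+ 2]. *)
have [N rN] := exists_expr_le r0 r1 (exprn_gt0 2 eta0).
exists (c *: \sum_(k < N) (1 - c *: (z%:P - 'X)) ^+ k) => x xB.
have -> : 1 - (z - x%:C) * (c *: \sum_(k < N) (1 - c *: (z%:P - 'X)) ^+ k).[x%:C] =
    (1 - c * (z - x%:C)) ^+ N.
  rewrite hornerZ horner_sum.
  under eq_bigr => k _ do rewrite horner_exp !(hornerE, hornerZ).
  set t := c * (z - x%:C).
  rewrite mulrA [(z - _) * c]mulrC -/t -[RHS](subrK 1) subrX1 addrAC subrr add0r.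
  by rewrite mulNr addrC.
rewrite cmodX -(ler_pXn2r (n := 2)) ?nnegrE ?exprn_ge0 ?cmod_ge0 ?(ltW eta0)//.
rewrite exprAC (le_trans _ rN)// lerXn2r ?nnegrE ?exprn_ge0 ?cmod_ge0//.
exact: contr.
Qed.

End PowerBound.

(** * The resolvent of a free sum as a sum over alternating words *)

Section Resolvent.
Variables (R : realType) (A : starProbSpace R) (X : nat -> A).
Local Notation C := R[i].
Local Notation phi := (state A).
Hypotheses (saX : forall j, self_adjoint (X j)) (freeX : free_family X).
Local Notation ev i p := (horner_alg (X i) p).
Variables (n N : nat) (q : {poly C}).
Hypothesis q0 : forall i, phi (ev i q) = 0.

Local Notation alt := (altsum X n q).

Definition altsums i : A := \sum_(k < N) alt k i.

(** The truncation of [U] to words of length at most [N], grouped by first letter. *)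
Definition allsums : A := 1 + \sum_(j < n) ev j q * altsums j.

Lemma wspan_altsums i : wspan X i (altsums i).
Proof. by apply: wspan_sum => k _; exact: wspan_altsum. Qed.

Lemma state_allsums : phi allsums = 1.
Proof.
rewrite stateD state1 state_sum big1 ?addr0// => j _.
by rewrite (state_wspan_mul saX freeX)//; exact: wspan_altsums.
Qed.

(** The words not beginning with [i] make up [altsums i] and, at full length, [alt N i]; the others
    are [ev i q * altsums i]. *)
Lemma allsumsE i : (i < n)%N -> allsums = (1 + ev i q) * altsums i + alt N i.
Proof.
move=> iltn.
have E : \sum_(j < n) ev j q * altsums j =
    \sum_(k < N) alt k.+1 i + ev i q * altsums i.
  rewrite (bigD1 (Ordinal iltn))//= addrC; congr (_ + _).
  by rewrite exchange_big /=; apply: eq_bigr => j _; rewrite mulr_sumr.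
have T : \sum_(k < N) alt k.+1 i = altsums i - 1 + alt N i.
  have H : altsums i + alt N i = 1 + \sum_(k < N) alt k.+1 i.
    by rewrite /altsums -(big_ord_recr N (fun k => alt k i)) big_ord_recl.
  by apply: (addrI 1); rewrite addrA [1 + (_ - _)]addrC subrK H.
rewrite /allsums E T mulrDl mul1r.
set d := altsums i; set t := _ * d; set v := alt N i.
by rewrite [d - 1 + v]addrAC [d + v - 1 + t]addrAC addrCA subrr addr0 addrAC.
Qed.

Variables (e : R) (z w Z : C).
Hypothesis zwZ : z * w = n%:R * Z * w - (n%:R - 1).

Local Notation S := (e%:C *: \sum_(j < n) X j).

(** [1 + q] is meant to approximate the inverse of this polynomial on the support of [mu]. *)
Definition linpoly : {poly C} := w *: (Z%:P - e%:C *: 'X).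

(** By [zwZ], [w (z - S)] is the sum of the [linpoly(X_i)] minus [n - 1]. In the [i]-th summand
    [allsums] is regrouped by [allsumsE]. If [linpoly * (1 + q)] were [1] and the words were not
    truncated, only [1] would be left; the sum on the right is the resulting error. *)
Lemma resolvent_allsums : w *: ((z *: 1 - S) * allsums) = 1 +
  \sum_(i < n) (ev i (linpoly * (1 + q) - 1) * altsums i +
                ev i (linpoly - 1) * alt N i).
Proof.
have T (i : 'I_n) : ev i linpoly * allsums =
   (ev i (linpoly * (1 + q) - 1) * altsums i + ev i (linpoly - 1) * alt N i) +
   (allsums - ev i q * altsums i).
  rewrite !rmorphB !rmorphM rmorphD !rmorph1 !mulrBl !mul1r.
  rewrite {1}(allsumsE (ltn_ord i)) mulrDr mulrA.
  rewrite {1}(allsumsE (ltn_ord i)) mulrDl mul1r.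
  set t := ev i q * altsums i; rewrite [altsums i + t + alt N i - t]addrAC addrK.
  by rewrite [X in _ = X + _]addrACA -opprD subrK.
have Sl : \sum_(i < n) ev i linpoly = (n%:R * (w * Z)) *: 1 - w *: S.
  rewrite (eq_bigr (fun i : 'I_n => (w * Z) *: 1 - (w * e%:C) *: X i)); last first.
    move=> i _; rewrite /linpoly -mul_polyC rmorphM rmorphB /= -mul_polyC rmorphM /=.
    by rewrite !horner_algC horner_algX -!scalerAl !mul1r scalerBr !scalerA.
  rewrite sumrB sumr_const card_ord -scaler_sumr scalerA; congr (_ - _).
  by rewrite mulr_natl scalerMnl.
have : \sum_(i < n) ev i linpoly * allsums = _ := eq_bigr _ (fun i (_ : true) => T i).
rewrite big_split /= -mulr_suml Sl sumrB sumr_const card_ord.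
set r := \sum_(i < n) (_ + _); set a := allsums.
have -> : \sum_(i < n) ev i q * altsums i = allsums - 1.
  by rewrite /allsums addrAC subrr add0r.
move=> H.
have -> : w *: ((z *: 1 - S) * allsums) =
    ((n%:R * (w * Z)) *: 1 - w *: S) * allsums - (n%:R - 1) *: allsums.
  rewrite scalerAl scalerBr [w *: (z *: 1)]scalerA [w * z]mulrC zwZ.
  rewrite -/a (_ : n%:R * Z * w = n%:R * (w * Z)); last by ring.
  rewrite scalerBl addrAC [LHS]mulrBl; congr (_ - _).
  by rewrite -scalerAl mul1r.
rewrite H scalerBl scale1r scaler_nat -[_ + _ - _]addrA [RHS]addrC; congr (_ + _).
by rewrite !opprB -addrA subrKA addrC subrK.
Qed.


Variables (mu nu : probability (measurableTypeR R) R) (L B : R).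
Hypotheses (muL : carried mu L) (nuB : carried nu B).
Hypothesis momX : forall j k, phi (X j ^+ k) = (moment mu k)%:C.
Hypothesis momS : forall k, phi (S ^+ k) = (moment nu k)%:C.

Lemma self_adjoint_sum : self_adjoint S.
Proof.
rewrite /self_adjoint starZc star_sum conjc_real.
by congr (_ *: _); apply: eq_bigr => i _; exact: saX.
Qed.

Variables (rho Mq Mg eh : R).
Hypotheses (n0 : (0 < n)%N) (rho0 : 0 <= rho) (rho1 : rho < 1).
Hypothesis q_rho : n.-1%:R * (\int[mu]_t (cmod q.[t%:C] ^+ 2)) <= rho ^+ 2.
Hypotheses (Mq0 : 0 <= Mq) (q_le : forall t : R, `|t| <= L -> cmod q.[t%:C] <= Mq).
Hypotheses (Mg0 : 0 <= Mg)
  (g_le : forall t : R, `|t| <= L -> cmod (linpoly - 1).[t%:C] <= Mg).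
Hypotheses (eh0 : 0 <= eh) (h_le : forall t : R, `|t| <= L ->
  cmod (linpoly * (1 + q) - 1).[t%:C] <= eh).

Lemma nrm_altsum_le k i : (i < n)%N -> nrm (alt k i) <= rho ^+ k.
Proof.
move=> iltn; rewrite -(ler_pXn2r (n := 2)) ?nnegrE ?exprn_ge0 ?nrm_ge0//.
rewrite sqr_nrm (nrm2_altsum saX freeX q0 _ iltn
  (fun j => nrm2_horner_alg muL (saX j) (momX j) q)).
rewrite exprAC lerXn2r ?nnegrE ?sqr_ge0// mulr_ge0//.
by apply: Rintegral_ge0 => t _; rewrite sqr_ge0.
Qed.

Lemma nrm_altsums_le i : (i < n)%N -> nrm (altsums i) <= (1 - rho)^-1.
Proof.
move=> iltn; apply: le_trans (sum_expr_le N rho0 rho1).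
by rewrite (le_trans (nrm_sum _ _ _))//; apply: ler_sum => k _; exact: nrm_altsum_le.
Qed.

Lemma nrm_allsums_le : nrm allsums <= (1 + Mq) * (1 - rho)^-1 + 1.
Proof.
rewrite (allsumsE n0) mulrDl mul1r (le_trans (nrmD _ _))//.
rewrite lerD//; last by rewrite (le_trans (nrm_altsum_le _ n0))// exprn_ile1// ltW.
rewrite mulrDl mul1r (le_trans (nrmD _ _))// lerD ?nrm_altsums_le//.
rewrite (nrm_wspan saX freeX); last exact: wspan_altsums.
rewrite ler_pM ?nrm_ge0 ?nrm_altsums_le//.
exact: (nrm_horner_alg_le muL (saX 0) (momX 0) q_le Mq0).
Qed.

(** The term in [eh] measures how far [1 + q] is from an inverse, the term in [rho ^+ N] the
    truncation. *)
Lemma nrm_remainder_le :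
  nrm (\sum_(i < n) (ev i (linpoly * (1 + q) - 1) * altsums i +
                ev i (linpoly - 1) * alt N i)) <=
  n%:R * (eh * (1 - rho)^-1 + Mg * rho ^+ N).
Proof.
rewrite (le_trans (nrm_sum _ _ _))// mulr_natl -[n in leRHS]card_ord -sumr_const.
apply: ler_sum => i _; rewrite (le_trans (nrmD _ _))//.
rewrite !(nrm_wspan saX freeX); [|exact: wspan_altsum|exact: wspan_altsums].
rewrite lerD// ler_pM ?nrm_ge0 ?nrm_altsums_le ?nrm_altsum_le//.
  exact: (nrm_horner_alg_le muL (saX i) (momX i) h_le eh0).
exact: (nrm_horner_alg_le muL (saX i) (momX i) g_le Mg0).
Qed.

(** A polynomial [P] close to [1 / (z - x)] stands in for the resolvent of [S]. Multiplying
    [resolvent_allsums] by [P(S)] and taking the state compares [w] with the state of [P(S)]; the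
    errors from [1 - (z - S) P(S)] and from the remainder are bounded by Cauchy-Schwarz. *)
Lemma state_resolvent_le (P : {poly C}) (eP MP : R) : 0 <= eP -> 0 <= MP ->
  (forall x : R, `|x| <= B -> cmod (1 - (z - x%:C) * P.[x%:C]) <= eP) ->
  (forall x : R, `|x| <= B -> cmod P.[x%:C] <= MP) ->
  cmod (w - cint nu (fun x => P.[x%:C])) <=
  cmod w * (eP * ((1 + Mq) * (1 - rho)^-1 + 1)) +
  MP * (n%:R * (eh * (1 - rho)^-1 + Mg * rho ^+ N)).
Proof.
move=> eP0 MP0 PeP PMP; have saS := self_adjoint_sum.
rewrite -(state_horner_alg nuB momS); set PS := horner_alg S P.
set r := \sum_(i < n) (ev i (linpoly * (1 + q) - 1) * altsums i +
                ev i (linpoly - 1) * alt N i).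
pose g := 1 - (z%:P - 'X) * P.
have gS : horner_alg S g = 1 - PS * (z *: 1 - S).
  by rewrite /g mulrC rmorphB rmorphM rmorphB rmorph1 /= horner_algC horner_algX.
have E : w - phi PS = w * phi (horner_alg S g * allsums) + phi (PS * r).
  have RA := resolvent_allsums; rewrite -/r in RA.
  have := congr1 (fun a => phi (PS * a)) RA.
  have -> : PS * (1 + r) = PS + PS * r by rewrite mulrDr mulr1.
  rewrite stateD -scalerAr stateZ mulrA.
  have -> : PS * (z *: 1 - S) = 1 - horner_alg S g.
    by rewrite gS opprB [RHS]addrC subrK.
  rewrite [(1 - _) * _]mulrBl mul1r stateB state_allsums mulrBr mulr1.
  set T := w * phi _ => E; rewrite -[w in LHS](subrK T) E; ring.
(* Cauchy-Schwarz has its left factor under [star], hence the conjugate polynomial. *)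
have CS p b : cmod (phi (horner_alg S p * b)) <=
    nrm (horner_alg S (map_poly (@conjc R) p)) * nrm b.
  have := state_Cauchy_Schwarz (horner_alg S (map_poly (@conjc R) p)) b.
  rewrite star_horner_alg// -map_poly_comp map_poly_id// => c _ /=.
  by rewrite conjcK.
have conj_le p M : (forall x : R, `|x| <= B -> cmod p.[x%:C] <= M) ->
    forall x : R, `|x| <= B -> cmod (map_poly (@conjc R) p).[x%:C] <= M.
  move=> pM x /pM; rewrite horner_conj_real; apply: le_trans.
  by rewrite -lecR -!cmodE normcJ.
rewrite E (le_trans (cmodD _ _))// lerD//.
  rewrite cmodM ler_wpM2l ?cmod_ge0// (le_trans (CS _ _))//.
  rewrite ler_pM ?nrm_ge0 ?nrm_allsums_le//.
  apply: (nrm_horner_alg_le nuB saS momS) => //; apply: conj_le => x xB.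
  by rewrite !hornerE; exact: PeP.
rewrite (le_trans (CS _ _))// ler_pM ?nrm_ge0 ?nrm_remainder_le//.
by apply: (nrm_horner_alg_le nuB saS momS) => //; exact: conj_le.
Qed.

End Resolvent.

(** * The subordination equation determines the Cauchy transform in the upper half-plane *)

Section Subordination.
Variable R : realType.
Local Notation C := R[i].

Section UpperHalfPlane.
Variables (e : R) (Z : C).
Hypothesis Z0 : 0 < complex.Im Z.

Let k (t : R) : C := Z - (e * t)%:C.

Lemma Im_le_cmod_sub t : complex.Im Z <= cmod (k t).
Proof.
rewrite (le_trans _ (normr_Im_le_cmod _))// /k !complexReE /= oppr0 addr0.
exact: ler_norm.
Qed.

Lemma cmod_sub_gt0 t : 0 < cmod (k t).
Proof. exact: lt_le_trans (Im_le_cmod_sub t). Qed.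

Lemma sub_neq0 t : k t != 0.
Proof. by rewrite -cmod_gt0 cmod_sub_gt0. Qed.

Lemma cmod_inv_sub_le t : cmod (k t)^-1 <= (complex.Im Z)^-1.
Proof.
by rewrite cmodV lef_pV2 ?posrE ?cmod_sub_gt0//; exact: Im_le_cmod_sub.
Qed.

Lemma cmeas_inv_sub : @cmeas R (fun t => (k t)^-1).
Proof.
apply: cmeasV; apply: cmeasB; first exact: cmeas_cst.
under eq_fun do rewrite rmorphM.
by apply: cmeasM; [exact: cmeas_cst|exact: cmeas_id].
Qed.

End UpperHalfPlane.

Section MasterIdentity.
Variables (mu : probability (measurableTypeR R) R) (L e : R) (Z w : C).
Hypotheses (muL : carried mu L) (Z0 : 0 < complex.Im Z).
Hypothesis wE : w = cint mu (fun t => (Z - (e * t)%:C)^-1).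

Let k (t : R) : C := Z - (e * t)%:C.
Let J : R := \int[mu]_t (cmod (k t) ^+ 2)^-1.
Let H := cmod Z + `|e * L|.

Let inv_int : cintegrable mu (fun t => (k t)^-1).
Proof.
apply: (carried_cintegrable muL (cmeas_inv_sub e Z)) => t _.
exact: cmod_inv_sub_le.
Qed.

Lemma cmod_sub_le t : `|t| <= L -> cmod (Z - (e * t)%:C) <= cmod Z + `|e * L|.
Proof.
move=> tL; rewrite (le_trans (cmodB _ _))// lerD2l cmod_real !normrM.
by rewrite ler_wpM2l// (le_trans tL)// ler_norm.
Qed.

Let J_int : mu.-integrable setT (EFin \o (fun t => (cmod (k t) ^+ 2)^-1)).
Proof.
apply: (carried_integrable muL (C := (complex.Im Z)^-1 ^+ 2)).
  under eq_fun do rewrite -exprVn -cmodV.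
  exact: (cmeas_sqr (cmeas_inv_sub e Z)).
move=> t _; rewrite -exprVn -cmodV ger0_norm ?sqr_ge0//.
by rewrite lerXn2r ?nnegrE ?cmod_ge0 ?cmod_inv_sub_le// invr_ge0 ltW.
Qed.

Lemma Im_cint_inv : complex.Im w = - (complex.Im Z * J).
Proof.
rewrite wE /= -RintegralZl// -[RHS]mulN1r -RintegralZl//; last exact: integrable_scale.
apply: eq_Rintegral => t _; rewrite complexReImV -/(k t) mulN1r; congr (- (_ / _)).
by rewrite /k !complexReE /= oppr0 addr0.
Qed.

Lemma J_gt0 : 0 < J.
Proof.
have H0 : 0 < H by rewrite ltr_wpDr// cmod_gt0; apply: contraTneq Z0 => ->; rewrite ltxx.
apply: (@lt_le_trans _ _ (H ^+ 2)^-1); first by rewrite invr_gt0 exprn_gt0.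
rewrite -[leLHS](Rintegral_prob_cst mu) (carried_le_Rintegral muL)//.
  exact: integrable_prob_cst.
move=> t tL; rewrite lef_pV2 ?posrE ?exprn_gt0 ?cmod_sub_gt0//.
by rewrite lerXn2r ?nnegrE ?cmod_ge0 ?(ltW H0)// cmod_sub_le.
Qed.

(** Its imaginary part [- (Im Z * J)] is negative. *)
Lemma cint_inv_neq0 : w != 0.
Proof.
apply/eqP => w0; have := Im_cint_inv; rewrite w0 /= => /esym/eqP.
by rewrite oppr_eq0 mulf_eq0 gt_eqF//= gt_eqF// J_gt0.
Qed.

(* Comparing imaginary parts in [z w = n Z w - (n - 1)] gives
   [(n - 1) v = 1 - Im z / Im Z]. *)
Lemma variance_lt1 n z : (0 < n)%N -> 0 < complex.Im z ->
  z * w = n%:R * Z * w - (n%:R - 1) ->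
  n.-1%:R * (\int[mu]_t (cmod ((w * k t)^-1 - 1) ^+ 2)) < 1.
Proof.
move=> n0 z0 zw; have w0 := cint_inv_neq0.
have W0 : 0 < cmod w ^+ 2 by rewrite exprn_gt0 // cmod_gt0.
(* [1 / (w k)] has mean one by [wE], so this variance is its second moment minus one. *)
have -> : \int[mu]_t (cmod ((w * k t)^-1 - 1) ^+ 2) = J / cmod w ^+ 2 - 1.
  pose g t := (cmod w ^+ 2)^-1 * (cmod (k t) ^+ 2)^-1.
  pose h t := complex.Re (w^-1 * (k t)^-1).
  have hi : mu.-integrable setT (EFin \o h).
    have [] // : cintegrable mu (fun t => w^-1 * (k t)^-1).
    apply: (carried_cintegrable muL (C := cmod w^-1 * (complex.Im Z)^-1)).
      by apply: cmeasM; [exact: cmeas_cst|exact: cmeas_inv_sub].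
    by move=> t _; rewrite cmodM ler_wpM2l ?cmod_ge0// cmod_inv_sub_le.
  have gi : mu.-integrable setT (EFin \o g) by exact: integrable_scale.
  have hE : \int[mu]_t h t = 1.
    have -> : \int[mu]_t h t = complex.Re (cint mu (fun t => w^-1 * (k t)^-1)) by [].
    by rewrite cintZ// -wE mulVf.
  transitivity (\int[mu]_t (g t - (2 * h t - 1))).
    apply: eq_Rintegral => t _; rewrite cmod_sqr !complexReE /=.
    have -> : g t = complex.Re (w * k t)^-1 ^+ 2 + complex.Im (w * k t)^-1 ^+ 2.
      by rewrite -cmod_sqr cmodV cmodM exprVn exprMn invfM.
    by rewrite /h -invfM; ring.
  have i1 : mu.-integrable setT (EFin \o (cst 1 : R -> R)) by exact: integrable_prob_cst.
  have i2 : mu.-integrable setT (EFin \o (fun t => 2 * h t)) by exact: integrable_scale.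
  have i3 : mu.-integrable setT (EFin \o (fun t => 2 * h t - 1)).
    exact: (integrableB measurableT i2 i1).
  rewrite RintegralB// (RintegralB measurableT i2 i1) !RintegralZl// hE.
  by rewrite Rintegral_prob_cst -/J; ring.
have zE : z = n%:R * Z - (n%:R - 1) * w^-1.
  by apply: (mulIf w0); rewrite zw; field.
(* Positivity of [Im z] makes the second factor positive, which is the claim. *)
have : complex.Im z = complex.Im Z * (n%:R - (n%:R - 1) * (J / cmod w ^+ 2)).
  have nE (m : R) u : complex.Im (m%:C * u) = m * complex.Im u.
    by rewrite !complexReE /= mul0r addr0.
  rewrite zE -(rmorph_nat (real_complex R)) -(rmorph1 (real_complex R)) -rmorphB.
  rewrite complexReE [complex.Im (- _)]complexReE !nE complexReImV Im_cint_inv.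
  by field; rewrite cmod_eq0.
move=> zE'; move: z0; rewrite zE' pmulr_rgt0// subr_gt0 -subn1 natrB// => lt.
by move: lt; rewrite mulrBr mulr1; set x := _ * (_ / _); lra.
Qed.

End MasterIdentity.

Section FreeSum.
Variables (A : starProbSpace R) (X : nat -> A).
Hypotheses (saX : forall j, self_adjoint (X j)) (freeX : free_family X).
Variables (mu nu : probability (measurableTypeR R) R) (L B e : R) (n : nat).
Hypotheses (muL : carried mu L) (nuB : carried nu B) (n0 : (0 < n)%N).
Hypothesis momX : forall j k, state A (X j ^+ k) = (moment mu k)%:C.
Hypothesis momS : forall k,
  state A ((e%:C *: \sum_(j < n) X j) ^+ k) = (moment nu k)%:C.
Variables (Z w z : C).
Hypotheses (Z0 : 0 < complex.Im Z) (z0 : 0 < complex.Im z).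
Hypothesis wE : w = cint mu (fun t => (Z - (e * t)%:C)^-1).
Hypothesis zw : z * w = n%:R * Z * w - (n%:R - 1).

Lemma resolvent_approx_scaled eta : 0 < eta -> exists Q : {poly C},
  forall t : R, `|t| <= L -> cmod (1 - (Z - (e * t)%:C) * Q.[t%:C]) <= eta.
Proof.
move=> eta0; have [P HP] := resolvent_approx `|e * L| Z0 eta0.
exists (P \Po (e%:C *: 'X)) => t tL; rewrite horner_comp !hornerE -rmorphM.
by apply: HP; rewrite !normrM ler_wpM2l// (le_trans tL)// ler_norm.
Qed.

(** The exact letters [f = 1 / (w (Z - e t)) - 1] are not polynomials. A polynomial [q] within
    [O(eta)] of [f] keeps the geometric ratio below one, and [state_resolvent_le] bounds the
    difference by [K * eta] with [K] independent of [eta]. *)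
Lemma cauchy_transform_free_sum : cint nu (fun x => (z - x%:C)^-1) = w.
Proof.
have w0 : w != 0 := cint_inv_neq0 muL Z0 wE.
pose f (t : R) : C := (w * (Z - (e * t)%:C))^-1 - 1.
set v := n.-1%:R * (\int[mu]_t (cmod (f t) ^+ 2)).
have v1 : v < 1 := variance_lt1 muL Z0 wE n0 z0 zw.
have v0 : 0 <= v.
  by rewrite mulr_ge0// Rintegral_ge0// => t _; rewrite sqr_ge0.
have W0 : 0 < cmod w by rewrite cmod_gt0.
pose y := complex.Im Z; have y0 : 0 < y by [].
pose H := cmod Z + `|e * L|; have H0 : 0 <= H by rewrite addr_ge0 ?cmod_ge0.
(* Bound for [|q - f| / eta]: one part from approximating the resolvent, two from approximating its
   mean. *)
pose c1 := 3 / (y * cmod w).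
have c10 : 0 <= c1 by rewrite divr_ge0// mulr_ge0// ltW.
have c1E : c1 = 3 / (y * cmod w) by []; clearbody c1.
pose F := (cmod w * y)^-1 + 1.
have F0 : 0 <= F by rewrite addr_ge0// invr_ge0 mulr_ge0// ltW.
(* Half-way between [v] and [1]; the slack absorbs the replacement of [f] by [q]. *)
pose b0 := (1 + v) / 2; pose rho := Num.sqrt b0.
have b0_ge0 : 0 <= b0 by rewrite /b0; lra.
have rho0 : 0 <= rho by exact: sqrtr_ge0.
have rho2 : rho ^+ 2 = b0 by rewrite sqr_sqrtr.
have rho1 : rho < 1.
  rewrite -(ltr_pXn2r (n := 2)) ?nnegrE// rho2 expr1n /b0; lra.
pose c2 := 2 * F * c1 + c1 ^+ 2.
have c20 : 0 <= c2 by rewrite addr_ge0 ?sqr_ge0// !mulr_ge0.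
have c2E : c2 = 2 * F * c1 + c1 ^+ 2 by []; clearbody c2.
(* Ensures [(n - 1) * c2 * eta <= (1 - v) / 2]. *)
pose eta0 := Num.min 1 ((1 - v) / (2 * (n.-1%:R * c2 + 1))).
have d0 : 0 < 2 * (n.-1%:R * c2 + 1) by rewrite mulr_gt0// ltr_wpDl// mulr_ge0.
have eta00 : 0 < eta0 by rewrite lt_min ltr01 divr_gt0// subr_gt0.
apply/eqP; rewrite -subr_eq0 -cmod_eq0 eq_le cmod_ge0 andbT cmodBC.
pose Mq := F + c1; have Mq0 : 0 <= Mq by rewrite addr_ge0.
pose yz := complex.Im z.
pose K := cmod w * ((1 + Mq) * (1 - rho)^-1 + 1) +
  (2 / yz) * (n%:R * ((1 + 2 * H / y) * (1 - rho)^-1 + 1)) + 2 / yz.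
apply: (@le0_of_le_mul _ _ K eta0 eta00) => eta eta_gt0.
rewrite le_min => /andP[eta1 eta_le].
have [Q HQ] := resolvent_approx_scaled eta_gt0.
pose c := cint mu (fun t => Q.[t%:C]).
(* Freeness requires exactly centred letters, so the mean of [Q] itself is subtracted, not the
   nearby [w]. *)
pose q : {poly C} := w^-1 *: (Q - c%:P).
have kinv t : cmod (Z - (e * t)%:C)^-1 <= y^-1 by exact: cmod_inv_sub_le.
have Qk t : `|t| <= L -> cmod (Q.[t%:C] - (Z - (e * t)%:C)^-1) <= eta / y.
  move=> tL; move: (kinv t) (HQ t tL) (sub_neq0 e Z0 t).
  set k := Z - _ => ki hq kn0.
  rewrite cmodBC (_ : k^-1 - Q.[t%:C] = (1 - k * Q.[t%:C]) * k^-1); last by field.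
  by rewrite cmodM ler_pM ?cmod_ge0.
have Qint := cintegrable_horner muL Q.
have cw : cmod (c - w) <= 2 * (eta / y).
  have [M QM] := horner_bounded L Q.
  rewrite wE -(carried_cintB muL (cmeas_horner Q) (cmeas_inv_sub e Z) QM (fun t _ => kinv t)).
  apply: (carried_cint_bound muL) => //.
  by apply: cmeasB; [exact: cmeas_horner|exact: cmeas_inv_sub].
have q0 i : state A (horner_alg (X i) q) = 0.
  rewrite /q -mul_polyC rmorphM rmorphB /= !horner_algC -scalerAl mul1r stateZ stateB.
  by rewrite stateZ state1 (state_horner_alg muL (momX i)) mulr1 subrr mulr0.
have qf t : `|t| <= L -> cmod (q.[t%:C] - f t) <= c1 * eta.
  move=> tL; have kn0 := sub_neq0 e Z0 t.
  have -> : q.[t%:C] - f t = (Q.[t%:C] - (Z - (e * t)%:C)^-1 - (c - w)) * w^-1.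
    rewrite /q /f !hornerE; move: kn0; set k := Z - _ => kn0; field; exact/andP.
  rewrite cmodM cmodV (_ : c1 * eta = (eta / y + 2 * (eta / y)) * (cmod w)^-1);
    last by rewrite c1E; field; rewrite !gt_eqF.
  by rewrite ler_wpM2r ?invr_ge0 ?cmod_ge0// (le_trans (cmodB _ _))// lerD// Qk.
have fF t : cmod (f t) <= F.
  rewrite (le_trans (cmodB _ _))// cmod1 lerD2r invfM cmodM invfM cmodV.
  by rewrite ler_wpM2l ?invr_ge0 ?cmod_ge0.
have qM t : `|t| <= L -> cmod q.[t%:C] <= Mq.
  move=> tL; rewrite -[q.[_]](subrK (f t)) addrC (le_trans (cmodD _ _))// lerD//.
  by rewrite (le_trans (qf _ tL))// ler_piMr.
have q_sqr t : `|t| <= L -> cmod q.[t%:C] ^+ 2 <= cmod (f t) ^+ 2 + c2 * eta.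
  move=> tL; have qfs : cmod q.[t%:C] <= cmod (f t) + c1 * eta.
    rewrite -[q.[_]](subrK (f t)) addrC (le_trans (cmodD _ _))// lerD2l.
    exact: qf.
  apply: (@le_trans _ _ ((cmod (f t) + c1 * eta) ^+ 2)).
    by rewrite lerXn2r ?nnegrE ?cmod_ge0// addr_ge0 ?cmod_ge0// mulr_ge0// ltW.
  rewrite sqrrD -addrA lerD2l c2E mulrDl lerD//.
    rewrite -mulr_natl !mulrA ler_wpM2r// ?(ltW eta_gt0)// ler_wpM2r//.
    by rewrite ler_wpM2l.
  by rewrite exprMn ler_wpM2l ?sqr_ge0// expr2 ler_piMr// ltW.
have fmeas : cmeas f.
  apply: cmeasB; last exact: cmeas_cst.
  under eq_fun do rewrite invfM.
  by apply: cmeasM; [exact: cmeas_cst|exact: cmeas_inv_sub].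
have f_int : mu.-integrable setT (EFin \o (fun t => cmod (f t) ^+ 2)).
  apply: (carried_integrable muL (C := F ^+ 2)); first exact: (cmeas_sqr fmeas).
  move=> t _; rewrite ger0_norm ?sqr_ge0// lerXn2r ?nnegrE ?cmod_ge0//.
have q_int : mu.-integrable setT (EFin \o (fun t => cmod q.[t%:C] ^+ 2)).
  apply: (carried_integrable muL (C := Mq ^+ 2)); first exact: (cmeas_sqr (cmeas_horner q)).
  move=> t tL; rewrite ger0_norm ?sqr_ge0// lerXn2r ?nnegrE ?cmod_ge0 ?Mq0 ?qM//.
have q_rho : n.-1%:R * (\int[mu]_t (cmod q.[t%:C] ^+ 2)) <= rho ^+ 2.
  apply: (@le_trans _ _ (n.-1%:R * (\int[mu]_t (cmod (f t) ^+ 2) + c2 * eta))).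
    rewrite ler_wpM2l// -[c2 * eta](Rintegral_prob_cst mu) -RintegralD//; last first.
      exact: integrable_prob_cst.
    apply: (carried_le_Rintegral muL q_int) => //.
    exact: (integrableD measurableT f_int (integrable_prob_cst mu _)).
  rewrite mulrDr -/v rho2 /b0 mulrA.
  have : n.-1%:R * c2 * eta <= (1 - v) / 2.
    apply: (@le_trans _ _ ((n.-1%:R * c2 + 1) * eta)).
      by rewrite ler_wpM2r ?(ltW eta_gt0)// lerDl.
    apply: (@le_trans _ _ ((n.-1%:R * c2 + 1) * ((1 - v) / (2 * (n.-1%:R * c2 + 1))))).
      by rewrite ler_wpM2l// addr_ge0// mulr_ge0.
    set D := _ + 1; have D0 : D != 0 by rewrite gt_eqF// ltr_wpDl// mulr_ge0.
    by rewrite (_ : D * ((1 - v) / (2 * D)) = (1 - v) / 2)//; field.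
  lra.
pose Mg := cmod w * H + 1.
have Mg0 : 0 <= Mg by rewrite addr_ge0// mulr_ge0 ?cmod_ge0.
have kH t : `|t| <= L -> cmod (Z - (e * t)%:C) <= H by exact: cmod_sub_le.
have lpE t : (linpoly e w Z).[t%:C] = w * (Z - (e * t)%:C).
  by rewrite /linpoly !hornerE rmorphM.
have g_le t : `|t| <= L -> cmod (linpoly e w Z - 1).[t%:C] <= Mg.
  move=> tL; rewrite hornerD hornerN hornerC lpE (le_trans (cmodB _ _))// cmod1.
  by rewrite lerD2r cmodM ler_wpM2l ?cmod_ge0 ?kH.
pose eh := (1 + 2 * H / y) * eta.
have eh0 : 0 <= eh by rewrite mulr_ge0 ?(ltW eta_gt0)// addr_ge0// !mulr_ge0// invr_ge0 ltW.
have h_le t : `|t| <= L -> cmod (linpoly e w Z * (1 + q) - 1).[t%:C] <= eh.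
  move=> tL; rewrite hornerD hornerN hornerC hornerM lpE.
  have -> : w * (Z - (e * t)%:C) * (1 + q).[t%:C] - 1 =
     - (1 - (Z - (e * t)%:C) * Q.[t%:C]) - (Z - (e * t)%:C) * (c - w).
    by rewrite /q !hornerE; field.
  rewrite (le_trans (cmodB _ _))// cmodN.
  rewrite (_ : eh = eta + H * (2 * (eta / y))); last by rewrite /eh; field; rewrite gt_eqF.
  by rewrite lerD ?HQ// cmodM ler_pM ?cmod_ge0 ?kH.
(* The truncation length is chosen after [eta]; [K] does not depend on it. *)
have [N HN] : exists N, Mg * rho ^+ N <= eta.
  have Mg1 : 0 < Mg by rewrite ltr_wpDl// mulr_ge0 ?cmod_ge0.
  have [N rN] := exists_expr_le rho0 rho1 (divr_gt0 eta_gt0 Mg1).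
  by exists N; rewrite mulrC -ler_pdivlMr.
have [P HP] := resolvent_approx B z0 eta_gt0.
have yz0 : 0 < yz by [].
have zx (x : R) : cmod (z - x%:C)^-1 <= yz^-1.
  by have := cmod_inv_sub_le 1 z0 x; rewrite mul1r.
have zx0 (x : R) : z - x%:C != 0 by have := sub_neq0 1 z0 x; rewrite mul1r.
have Pk (x : R) : `|x| <= B -> cmod (P.[x%:C] - (z - x%:C)^-1) <= eta / yz.
  move=> xB; rewrite cmodBC.
  rewrite (_ : _ - _ = (1 - (z - x%:C) * P.[x%:C]) * (z - x%:C)^-1); last first.
    by field; exact: zx0.
  by rewrite cmodM ler_pM ?cmod_ge0 ?HP.
have PM (x : R) : `|x| <= B -> cmod P.[x%:C] <= 2 / yz.
  move=> xB; rewrite -[P.[_]](subrK (z - x%:C)^-1) (le_trans (cmodD _ _))//.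
  rewrite mulrDl mul1r lerD// (le_trans (Pk _ xB))// ler_piMl// invr_ge0 ltW//.
have yz2 : 0 <= 2 / yz by rewrite divr_ge0// ltW.
have main := state_resolvent_le saX freeX N q0 zw muL nuB momX momS n0 rho0 rho1
  q_rho Mq0 qM Mg0 g_le eh0 h_le (ltW eta_gt0) yz2 HP PM.
have dP : cmod (cint nu (fun x => P.[x%:C]) - cint nu (fun x => (z - x%:C)^-1)) <=
    2 * (eta / yz).
  have zm : cmeas (fun x : R => (z - x%:C)^-1).
    by apply: cmeasV; apply: cmeasB; [exact: cmeas_cst|exact: cmeas_id].
  rewrite -(carried_cintB nuB (cmeas_horner P) zm PM (fun x _ => zx x)).
  apply: (carried_cint_bound nuB) => //.
  by apply: cmeasB => //; exact: cmeas_horner.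
rewrite -[w](subrK (cint nu (fun x => P.[x%:C]))) -addrA (le_trans (cmodD _ _))//.
rewrite (le_trans (lerD main dP))//.
apply: (@le_trans _ _ (cmod w * (eta * ((1 + Mq) * (1 - rho)^-1 + 1)) +
    2 / yz * (n%:R * (eh * (1 - rho)^-1 + eta)) + 2 * (eta / yz))).
  by rewrite lerD2r lerD2l ler_wpM2l// ler_wpM2l// lerD2l.
by rewrite /K /eh le_eqVlt; apply/orP; left; apply/eqP; ring.
Qed.

End FreeSum.

Lemma cauchy_transform_normalized_free_sum
    (mu nu : probability (measurableTypeR R) R) n (Z z : C) :
  normalized_free_sum_law mu n nu -> (0 < n)%N ->
  0 < complex.Im Z -> 0 < complex.Im z ->
  let w := cint mu (fun t => (Z - ((Num.sqrt n%:R)^-1 * t)%:C)^-1) in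
  z * w = n%:R * Z * w - (n%:R - 1) -> cauchy_transform nu z = w.
Proof.
move=> [A [X [saX momX freeX [nuc momS]]]] n0 Z0 z0 w zw.
have [L _ muL] := compact_msupp_carried (momX 0).1.
have [B _ nuB] := compact_msupp_carried nuc.
by apply: (cauchy_transform_free_sum saX freeX muL nuB n0 _ momS Z0 z0 _ zw) => // j; exact: (momX j).2.
Qed.

End Subordination.

(** * Moment series with remainder and their divided differences *)

Section GeometricIntegrals.
Variables (R : realType) (mu : probability (measurableTypeR R) R) (L e : R).
Local Notation C := R[i].
Hypotheses (muL : carried mu L) (L1 : 1 <= L) (e0 : 0 < e) (eL : 8 * e * L <= 1).
Implicit Types (om : C) (t : R) (p : nat).

(** For [om = 1 / Z] one has [1 / (Z - e t) = om * gker om t]. This form makes sense on the whole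
    disc of radius [4], since [8 e L <= 1] keeps [|e t om|] below [1 / 2]. *)
Definition gker om t : C := (1 - (e * t)%:C * om)^-1.

Definition gint p om : C := cint mu (fun t => t%:C ^+ p * gker om t).

(** The divided difference of [gint] up to a factor [e] and a shift of [p]. *)
Definition gint2 p om om' : C :=
  cint mu (fun t => t%:C ^+ p * (gker om t * gker om' t)).

Let L0 : 0 <= L. Proof. exact: le_trans L1. Qed.

Let cmod_den om t : cmod om <= 4 -> `|t| <= L ->
  2^-1 <= cmod (1 - (e * t)%:C * om).
Proof.
move=> om4 tL; have := cmod_ge 1 (- ((e * t)%:C * om)).
rewrite cmod1 cmodN cmodM cmod_real normrM (gtr0_norm e0).
have : e * `|t| * cmod om <= e * L * 4.
  by rewrite ler_pM ?cmod_ge0 ?mulr_ge0 ?ler_wpM2l ?(ltW e0).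
have eL' := eL; have : e * L * 4 <= 2^-1 by lra.
lra.
Qed.

Lemma cmod_gker om t : cmod om <= 4 -> `|t| <= L -> cmod (gker om t) <= 2.
Proof.
move=> om4 tL; have := cmod_den om4 tL => d2.
by rewrite cmodV -[2]invrK lef_pV2 ?posrE ?invr_gt0// (lt_le_trans _ d2) ?invr_gt0.
Qed.

Lemma gker_neq0 om t : cmod om <= 4 -> `|t| <= L -> 1 - (e * t)%:C * om != 0.
Proof.
move=> om4 tL; rewrite -cmod_gt0; apply: lt_le_trans (cmod_den om4 tL).
by rewrite invr_gt0.
Qed.

Lemma cmeas_gker om : @cmeas R (gker om).
Proof.
apply: cmeasV; apply: cmeasB; first exact: cmeas_cst.
apply: cmeasM; last exact: cmeas_cst.
under eq_fun do rewrite rmorphM.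
by apply: cmeasM; [exact: cmeas_cst|exact: cmeas_id].
Qed.

Lemma cmeas_pow p : @cmeas R (fun t => t%:C ^+ p).
Proof. by apply: cmeasX; exact: cmeas_id. Qed.

Lemma cmod_pow p t : `|t| <= L -> cmod (t%:C ^+ p) <= L ^+ p.
Proof. by move=> tL; rewrite cmodX cmod_real lerXn2r ?nnegrE. Qed.

Let bound_mul (x y : C) (a b : R) : cmod x <= a -> cmod y <= b ->
  cmod (x * y) <= a * b.
Proof. by move=> xa yb; rewrite cmodM ler_pM ?cmod_ge0. Qed.

Lemma cmod_gint p om : cmod om <= 4 -> cmod (gint p om) <= 2 * (L ^+ p * 2).
Proof.
move=> om4; apply: (carried_cint_bound muL).
  by apply: cmeasM; [exact: cmeas_pow|exact: cmeas_gker].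
by move=> t tL; rewrite bound_mul ?cmod_pow ?cmod_gker.
Qed.

Lemma cmod_gint2 p om om' : cmod om <= 4 -> cmod om' <= 4 ->
  cmod (gint2 p om om') <= 2 * (L ^+ p * (2 * 2)).
Proof.
move=> om4 om4'; apply: (carried_cint_bound muL).
  by apply: cmeasM; [exact: cmeas_pow|apply: cmeasM; exact: cmeas_gker].
by move=> t tL; rewrite bound_mul ?cmod_pow// bound_mul ?cmod_gker.
Qed.

Lemma cint_pow p : cint mu (fun t => t%:C ^+ p) = (moment mu p)%:C.
Proof.
apply: complex_eqP; rewrite /= /moment.
  by apply: eq_Rintegral => t _; rewrite -rmorphXn.
rewrite -[RHS](Rintegral_prob_cst mu); apply: eq_Rintegral => t _.
by rewrite -rmorphXn.
Qed.

(** The identity [1 / (1 - x) = 1 + x / (1 - x)] under the integral; iteration produces the moment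
    expansion. *)
Lemma gint_rec p om : cmod om <= 4 ->
  gint p om = (moment mu p)%:C + e%:C * om * gint p.+1 om.
Proof.
move=> om4; have mg q : @cmeas R (fun t => t%:C ^+ q * gker om t).
  by apply: cmeasM; [exact: cmeas_pow|exact: cmeas_gker].
have bg q t : `|t| <= L -> cmod (t%:C ^+ q * gker om t) <= L ^+ q * 2.
  by move=> tL; rewrite bound_mul ?cmod_pow ?cmod_gker.
have gi q := carried_cintegrable muL (mg q) (bg q).
have pi := carried_cintegrable muL (cmeas_pow p) (cmod_pow p).
rewrite -cint_pow -cintZ// -cintD//; last first.
  apply: (carried_cintegrable muL (C := cmod (e%:C * om) * (L ^+ p.+1 * 2))).
    by apply: cmeasM => //; exact: cmeas_cst.
  by move=> t tL; rewrite bound_mul ?bg.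
apply: (carried_eq_cint muL (mg p) _ (bg p)) => [|t tL].
  by apply: cmeasD; [exact: cmeas_pow|apply: cmeasM => //; exact: cmeas_cst].
have := gker_neq0 om4 tL; rewrite /gker rmorphM /= exprS => k0.
by field.
Qed.

(** The resolvent identity. Being exact, it gives Lipschitz bounds and complex derivatives without
    differentiation under the integral. *)
Lemma gintB p om om' : cmod om <= 4 -> cmod om' <= 4 ->
  gint p om - gint p om' = e%:C * (om - om') * gint2 p.+1 om om'.
Proof.
move=> om4 om4'; have mg q om1 : @cmeas R (fun t => t%:C ^+ q * gker om1 t).
  by apply: cmeasM; [exact: cmeas_pow|exact: cmeas_gker].
have bg q om1 (om14 : cmod om1 <= 4) t : `|t| <= L ->
    cmod (t%:C ^+ q * gker om1 t) <= L ^+ q * 2.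
  by move=> tL; rewrite bound_mul ?cmod_pow ?cmod_gker.
have mg2 q : @cmeas R (fun t => t%:C ^+ q * (gker om t * gker om' t)).
  by apply: cmeasM; [exact: cmeas_pow|apply: cmeasM; exact: cmeas_gker].
rewrite -(carried_cintB muL (mg p om) (mg p om') (bg p om om4) (bg p om' om4')).
rewrite -cintZ; last first.
  apply: (carried_cintegrable muL (mg2 _) (C := L ^+ p.+1 * (2 * 2))) => t tL.
  by rewrite bound_mul ?cmod_pow// bound_mul ?cmod_gker.
apply: (carried_eq_cint muL (C := L ^+ p * 2 + L ^+ p * 2)) => [||t tL|t tL].
- exact: cmeasB.
- by apply: cmeasM => //; exact: cmeas_cst.
- by rewrite (le_trans (cmodB _ _))// lerD ?bg.
have := gker_neq0 om4 tL; have := gker_neq0 om4' tL.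
rewrite /gker rmorphM /= exprS => k0' k0.
by field; apply/andP.
Qed.

(** The resolvent identity once more; it makes the divided difference continuous at the diagonal. *)
Lemma gint2_lip p om om' : cmod om <= 4 -> cmod om' <= 4 ->
  cmod (gint2 p om' om - gint2 p om om) <=
  2 * (L ^+ p.+1 * (2 * 2 * 2)) * e * cmod (om' - om).
Proof.
move=> om4 om4'.
have mg2 q om1 : @cmeas R (fun t => t%:C ^+ q * (gker om1 t * gker om t)).
  by apply: cmeasM; [exact: cmeas_pow|apply: cmeasM; exact: cmeas_gker].
have bg2 q om1 (om14 : cmod om1 <= 4) t : `|t| <= L ->
    cmod (t%:C ^+ q * (gker om1 t * gker om t)) <= L ^+ q * (2 * 2).
  by move=> tL; rewrite bound_mul ?cmod_pow// bound_mul ?cmod_gker.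
rewrite -(carried_cintB muL (mg2 p om') (mg2 p om) (bg2 p om' om4') (bg2 p om om4)).
pose C1 := e * cmod (om' - om) * (L ^+ p.+1 * (2 * 2 * 2)).
rewrite (_ : _ * _ = 2 * C1); last by rewrite /C1; ring.
apply: (carried_cint_bound muL) => [|t tL]; first exact: cmeasB.
have := gker_neq0 om4 tL; have := gker_neq0 om4' tL => k0' k0.
rewrite (_ : _ - _ = e%:C * (om' - om) *
    (t%:C ^+ p.+1 * (gker om' t * gker om t * gker om t))); last first.
  by move: k0 k0'; rewrite /gker rmorphM /= exprS => k0 k0'; field; rewrite k0.
rewrite bound_mul//; first by rewrite cmodM cmod_real gtr0_norm.
by rewrite bound_mul ?cmod_pow// !bound_mul ?cmod_gker.
Qed.

End GeometricIntegrals.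

(** * A fixed-point theorem on closed discs *)

Section Contraction.
Variable R : realType.

Lemma le0_of_le_expr (x c : R) : 0 <= c ->
  (forall k, x <= c * 2^-1 ^+ k) -> x <= 0.
Proof.
move=> c0 H; apply: (@le0_of_le_mul _ x c 1) => // eta eta0 _.
have [||k ke] := @exists_expr_le R 2^-1 eta _ _ eta0.
- by rewrite invr_ge0.
- by rewrite invf_lt1// ltr1n.
- by rewrite (le_trans (H k))// ler_wpM2l.
Qed.

(** The sequences [x k - q k] and [x k + q k] are monotone and enclose the limit, which is the
    supremum of the lower one. *)
Lemma geometric_limit (x : nat -> R) (r : R) : 0 <= r ->
  (forall k, `|x k.+1 - x k| <= r * 2^-1 ^+ k) ->
  exists l, forall k, `|x k - l| <= 2 * r * 2^-1 ^+ k.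
Proof.
move=> r0 H; pose q k := 2 * r * 2^-1 ^+ k : R.
have qS k : q k - q k.+1 = r * 2^-1 ^+ k by rewrite /q exprS; field.
have H1 k : - (r * 2^-1 ^+ k) <= x k.+1 - x k <= r * 2^-1 ^+ k by rewrite -ler_norml.
pose a k := x k - q k; pose b k := x k + q k.
have a_nd : nondecreasing_seq a.
  apply/nondecreasing_seqP => k; rewrite /a; have := H1 k; have := qS k; lra.
have b_ni : nonincreasing_seq b.
  apply/nonincreasing_seqP => k; rewrite /b; have := H1 k; have := qS k; lra.
have q0 k : 0 <= q k by rewrite !mulr_ge0// exprn_ge0.
have ab k m : a k <= b m.
  apply: (le_trans (a_nd _ _ (leq_maxl k m))).
  apply: le_trans (b_ni _ _ (leq_maxr k m)).
  by rewrite /a /b; have := q0 (maxn k m); lra.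
have sa : has_sup (range a).
  split; first by exists (a 0%N), 0%N.
  by exists (b 0%N) => _ [k _ <-].
exists (sup (range a)) => k.
have l1 : a k <= sup (range a) by apply: sup_upper_bound => //; exists k.
have l2 : sup (range a) <= b k.
  by apply: ge_sup; [case: sa|move=> _ [m _ <-]].
by rewrite distrC ler_distl -/(q k); apply/andP.
Qed.

(** Banach iteration from the centre, with real and imaginary parts converging separately. *)
Lemma contraction_fixpoint (f : R[i] -> R[i]) (G : R[i]) (r : R) : 0 <= r ->
  (forall u, cmod (u - G) <= r -> cmod (f u - G) <= r) ->
  (forall u v, cmod (u - G) <= r -> cmod (v - G) <= r ->
    cmod (f u - f v) <= 2^-1 * cmod (u - v)) ->
  exists2 u, cmod (u - G) <= r & f u = u.
Proof.
move=> r0 fG fL; pose u k := iter k f G.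
have uG k : cmod (u k - G) <= r.
  by elim: k => [|k IH] /=; [rewrite subrr cmod0|exact: fG].
have uS k : cmod (u k.+1 - u k) <= r * 2^-1 ^+ k.
  elim: k => [|k IH]; first by rewrite expr0 mulr1; exact: uG.
  rewrite exprS mulrCA (le_trans (fL _ _ (uG k.+1) (uG k)))//.
  by rewrite ler_wpM2l// invr_ge0.
have [l1 H1] : exists l, forall k, `|complex.Re (u k) - l| <= 2 * r * 2^-1 ^+ k.
  apply: geometric_limit => // k.
  by apply: le_trans (uS k); rewrite (le_trans _ (normr_Re_le_cmod _))// !complexReE.
have [l2 H2] : exists l, forall k, `|complex.Im (u k) - l| <= 2 * r * 2^-1 ^+ k.
  apply: geometric_limit => // k.
  by apply: le_trans (uS k); rewrite (le_trans _ (normr_Im_le_cmod _))// !complexReE.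
pose l := l1 +i* l2.
have ul k : cmod (u k - l) <= 4 * r * 2^-1 ^+ k.
  rewrite (le_trans (cmod_le_ReIm _))// !complexReE /=.
  by have := H1 k; have := H2 k; lra.
have r4 : 0 <= 4 * r by rewrite mulr_ge0.
have lG : cmod (l - G) <= r.
  rewrite -subr_le0; apply: (le0_of_le_expr r4) => k.
  rewrite lerBlDr -(subrK (u k) l) -addrA (le_trans (cmodD _ _))// lerD//.
  by rewrite cmodBC.
exists l => //; apply/eqP; rewrite -subr_eq0 -cmod_eq0 eq_le cmod_ge0 andbT.
have r8 : 0 <= 8 * r by rewrite mulr_ge0.
apply: (le0_of_le_expr r8) => k.
rewrite -(subrK (f (u k)) (f l)) -addrA (le_trans (cmodD _ _))//.
have /le_trans -> // := lerD (fL _ _ lG (uG k)) (ul k.+1).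
rewrite cmodBC exprS; have := ul k; have : 0 <= r * 2^-1 ^+ k by rewrite mulr_ge0// exprn_ge0.
lra.
Qed.

End Contraction.

(** * Limits and complex derivability in terms of the modulus *)

Section ComplexLimits.
Variable R : realType.
Local Notation C := R[i].

Lemma near_cmod (z : C) (P : C -> Prop) (r : R) : 0 < r ->
  (forall w, cmod (w - z) < r -> P w) -> \forall w \near (z : C^o), P w.
Proof.
move=> r0 H; apply/nbhs_ballP; exists r%:C; first by rewrite /= ltcR.
by move=> w; rewrite /ball /= distrC cmodE ltcR; exact: H.
Qed.

Lemma near0_cmod (P : C -> Prop) (r : R) : 0 < r ->
  (forall h, h != 0 -> cmod h < r -> P h) -> \forall h \near (0 : C^o)^', P h.
Proof.
move=> r0 H; apply: (near_cmod r0) => h; rewrite subr0 => hr h0; exact: H.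
Qed.

Lemma cvg0_cmod (f : C -> C) (l : C) (r M : R) : 0 < r ->
  (forall h, h != 0 -> cmod h < r -> cmod (f h - l) <= M * cmod h) ->
  (f : C^o -> C^o) h @[h --> (0 : C^o)^'] --> (l : C^o).
Proof.
move=> r0 H; apply/cvgrPdist_le => eps eps0.
(* A positive element of [R[i]] is real. *)
have [E E0 epsE] : exists2 E : R, 0 < E & eps = E%:C.
  by exists (complex.Re eps); move: eps0; rewrite ltcE /= => /andP[/eqP i0 ?] //; exact: complex_eqP.
pose M1 := `|M| + 1; have M10 : 0 < M1 by rewrite ltr_pwDr.
apply: (@near0_cmod _ (Num.min r (E / M1))); first by rewrite lt_min r0 divr_gt0.
move=> h h0; rewrite lt_min => /andP[hr hE].
rewrite distrC cmodE epsE lecR (le_trans (H _ h0 hr))//.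
apply: (@le_trans _ _ (M1 * cmod h)).
  by rewrite ler_wpM2r ?cmod_ge0// (le_trans (ler_norm _))// lerDl.
by rewrite mulrC -ler_pdivlMr// ltW.
Qed.

(* [f h] converges to [l] as [h] tends to [0]; a variant rather than a definition,
   to keep unification away from the normed structure of [R[i]^o]. *)
Variant tends0 (f : C -> C) (l : C) : Prop :=
  Tends0 of (f : C^o -> C^o) h @[h --> (0 : C^o)^'] --> (l : C^o).

Lemma tends0_cmod (f : C -> C) (l : C) (r M : R) : 0 < r ->
  (forall h, h != 0 -> cmod h < r -> cmod (f h - l) <= M * cmod h) -> tends0 f l.
Proof. by move=> r0 H; split; exact: (cvg0_cmod r0 H). Qed.

Lemma tends0_cst c : tends0 (fun=> c) c.
Proof. by split; exact: cvg_cst. Qed.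

Lemma tends0_id c : tends0 (fun h => h + c) c.
Proof.
by apply: (@tends0_cmod _ _ 1 1) => // h _ _; rewrite addrK mul1r.
Qed.

Lemma tends0D f g a b : tends0 f a -> tends0 g b ->
  tends0 (fun h => f h + g h) (a + b).
Proof. by move=> [fa] [gb]; split; exact: (cvgD fa gb). Qed.

Lemma tends0N f a : tends0 f a -> tends0 (fun h => - f h) (- a).
Proof. by move=> [fa]; split; exact: (@cvgN C C^o C^o). Qed.

Lemma tends0M f g a b : tends0 f a -> tends0 g b ->
  tends0 (fun h => f h * g h) (a * b).
Proof. by move=> [fa] [gb]; split; exact: (cvgM fa gb). Qed.

Lemma tends0V f a : a != 0 -> tends0 f a -> tends0 (fun h => (f h)^-1) a^-1.
Proof. by move=> a0 [fa]; split; exact: (@cvgV C C^o). Qed.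

Lemma tends0X f a n : tends0 f a -> tends0 (fun h => f h ^+ n) (a ^+ n).
Proof.
move=> fa; elim: n => [|n IH]; first exact: tends0_cst.
rewrite exprS; under eq_fun do rewrite exprS.
exact: tends0M.
Qed.

Lemma derivable_tends0 (f g : C -> C) (z l : C) (r : R) : 0 < r ->
  (forall h, h != 0 -> cmod h < r -> h^-1 * (f (h + z) - f z) = g h) ->
  tends0 g l -> derivable (f : C^o -> C^o) (z : C^o) 1.
Proof.
move=> r0 fg [gl]; rewrite /derivable; apply/cvg_ex; exists (l : C^o); apply: cvg_trans gl.
apply: near_eq_cvg; apply: (near0_cmod r0) => h h0 hr /=.
by rewrite -[h *: (1 : C^o)]/(h * 1) mulr1 -(fg h h0 hr).
Qed.

End ComplexLimits.

Ltac tends0_tac := lazymatch goal with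
  | |- tends0 _ (_ + _) => apply: tends0D; tends0_tac
  | |- tends0 _ (_ * _) => apply: tends0M; tends0_tac
  | |- tends0 _ (- _) => apply: tends0N; tends0_tac
  | |- tends0 _ (_ ^+ _) => apply: tends0X; tends0_tac
  | |- _ => first [eassumption | exact: tends0_cst]
  end.

(** * Bounds for polynomial expressions *)

Section BoundedTerms.
Variable R : realType.
Implicit Types (x y : R[i]) (a b : R).

Lemma cmodD_le x y a b : cmod x <= a -> cmod y <= b -> cmod (x + y) <= a + b.
Proof. by move=> xa yb; rewrite (le_trans (cmodD _ _))// lerD. Qed.

Lemma cmodN_le x a : cmod x <= a -> cmod (- x) <= a.
Proof. by rewrite cmodN. Qed.

Lemma cmodM_le x y a b : cmod x <= a -> cmod y <= b -> cmod (x * y) <= a * b.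
Proof. by move=> xa yb; rewrite cmodM ler_pM ?cmod_ge0. Qed.

Lemma cmodX_le x a n : cmod x <= a -> cmod (x ^+ n) <= a ^+ n.
Proof.
by move=> xa; rewrite cmodX lerXn2r ?nnegrE ?cmod_ge0// (le_trans _ xa) ?cmod_ge0.
Qed.

Lemma cmod_nat_le n : cmod (n%:R : R[i]) <= n%:R.
Proof. by rewrite cmod_nat. Qed.

Lemma cmod1_le : cmod (1 : R[i]) <= 1.
Proof. by rewrite cmod1. Qed.

End BoundedTerms.

(* The bound may be an existential variable, to be instantiated from the bounds on
   the atoms. *)
Ltac cmod_bound := lazymatch goal with
  | |- is_true (cmod (_ + _) <= _) => apply: cmodD_le; cmod_bound
  | |- is_true (cmod (- _) <= _) => apply: cmodN_le; cmod_bound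
  | |- is_true (cmod (_ * _) <= _) => apply: cmodM_le; cmod_bound
  | |- is_true (cmod (_ ^+ _) <= _) => apply: cmodX_le; cmod_bound
  | |- is_true (cmod 1 <= _) => exact: cmod1_le
  | |- is_true (cmod (_%:R) <= _) => exact: cmod_nat_le
  | |- _ => eassumption
  end.

(** * The perturbed quadratic equation and the analytic extension *)

Section PerturbedQuadratic.
Variable R : realType.
Local Notation C := R[i].
Variables (K e delta : R) (J : C -> C) (D : C -> C -> C).
Hypotheses (K1 : 1 <= K) (e0 : 0 < e) (d0 : 0 < delta) (d1 : delta < 1 / 10).
Hypothesis small : 5000 * K * e <= delta.
Hypothesis J1 : forall u, cmod u <= 4 -> cmod (J u - 1) <= K * e.
Hypothesis JD : forall u v, cmod u <= 4 -> cmod v <= 4 ->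
  J u - J v = e%:C * (u - v) * D u v.
Hypothesis DK : forall u v, cmod u <= 4 -> cmod v <= 4 -> cmod (D u v) <= K.
Hypothesis DL : forall u v, cmod u <= 4 -> cmod v <= 4 ->
  cmod (D u v - D v v) <= K * cmod (u - v).
Implicit Types z u v h : C.

Let s := Num.sqrt delta.

Let s0 : 0 < s. Proof. by rewrite sqrtr_gt0. Qed.

Let s2 : s ^+ 2 = delta. Proof. by rewrite sqr_sqrtr// ltW. Qed.

Let s13 : s < 1 / 3.
Proof.
rewrite -(ltr_pXn2r (n := 2)) ?nnegrE ?(ltW s0) ?s2//; have := d1; lra.
Qed.

Let Ke : K * e <= delta / 5000.
Proof. have := small; lra. Qed.

Let eKe : e <= K * e.
Proof. by rewrite ler_peMl// ltW. Qed.

Let e1 : e <= 1.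
Proof. have := Ke; have := eKe; have := d1; lra. Qed.

Let e1C : cmod e%:C <= 1.
Proof. by rewrite cmod_real gtr0_norm. Qed.

Let J2 u : cmod u <= 4 -> cmod (J u) <= 2.
Proof.
move=> u4; rewrite -[J u](subrK 1) (le_trans (cmodD _ _))// cmod1.
have := J1 u4; have := Ke; have := d1; lra.
Qed.

(** An open set containing [rectK delta], which leaves room for neighbourhoods of the points of
    [rectK delta]. *)
Definition wide_domain z :=
  `|complex.Re z| < 2 - delta /\ `|complex.Im z| < delta * s.

Let ds : delta * s <= s / 10.
Proof. by have := d1; have := s0; nra. Qed.

Lemma wide_domain_le3 z : wide_domain z -> cmod z <= 3.
Proof.
case=> rz iz; rewrite (le_trans (cmod_le_ReIm _))//.
have := ds; have := s13; have := d0; lra.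
Qed.

Lemma G_omega_root z : G_omega z * (z - G_omega z) = 1.
Proof.
have i2 := sqr_i R; have q2 := sqr_sqrtc (4 - z ^+ 2).
rewrite /G_omega; set q := sqrtc _ in q2 *.
have -> : (z - 'i%C * q) / 2 * (z - (z - 'i%C * q) / 2) =
  (z ^+ 2 - 'i%C ^+ 2 * q ^+ 2) / 4 by field.
by rewrite i2 q2; field.
Qed.

(** The real part of [4 - z ^+ 2] is at least [4 * delta - delta ^+ 2], so its root has real part at
    least [19 / 10 * s], while [|Im z| <= s / 10]. Hence the two roots [G] and [z - G] lie on
    opposite sides of the real axis. *)
Lemma G_omega_bounds z : wide_domain z ->
  [/\ complex.Im (G_omega z) <= - (4 / 5 * s),
      4 / 5 * s <= complex.Im (z - G_omega z) & cmod (G_omega z) <= 7 / 2].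
Proof.
move=> Kz; have z3 := wide_domain_le3 Kz; case: Kz => rz iz.
have q2 := sqr_sqrtc (4 - z ^+ 2); have q0 := Re_sqrtc_ge0 (4 - z ^+ 2).
rewrite /G_omega; set q := sqrtc _ in q2 q0 *.
have qs : 19 / 10 * s <= complex.Re q.
  rewrite -(ler_pXn2r (n := 2)) ?nnegrE ?mulr_ge0 ?(ltW s0)// exprMn s2.
  have := congr1 (@complex.Re R) q2.
  rewrite !expr2 !complexReE /= => Hq.
  have : complex.Re z * complex.Re z <= (2 - delta) ^+ 2.
    by rewrite -expr2 -real_normK ?num_real// lerXn2r ?nnegrE// ?(ltW rz)//; have := d1; lra.
  have : 0 <= complex.Im z * complex.Im z by rewrite -expr2 sqr_ge0.
  have : 0 <= complex.Im q * complex.Im q by rewrite -expr2 sqr_ge0.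
  have := d0; have := d1; nra.
have q4 : cmod q <= 4.
  rewrite -(ler_pXn2r (n := 2)) ?nnegrE ?cmod_ge0// -cmodX q2.
  rewrite (le_trans (cmodB _ _))// cmodX cmod_nat.
  have : cmod z ^+ 2 <= 3 ^+ 2 by rewrite lerXn2r ?nnegrE ?cmod_ge0.
  lra.
have E : (z - 'i%C * q) / 2 = (2^-1)%:C * (z - 'i%C * q).
  by rewrite mulrC fmorphV rmorph_nat.
have iE (x : C) : complex.Im (2^-1%:C * x) = 2^-1 * complex.Im x.
  by rewrite !complexReE /= mul0r addr0.
have iq : complex.Im ('i%C * q) = complex.Re q.
  by rewrite complexReE /= mul0r mul1r add0r.
have iz' : - (s / 10) <= complex.Im z <= s / 10.
  by rewrite -ler_norml (le_trans (ltW iz)).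
split.
- rewrite E iE complexReE [complex.Im (- _)]complexReE iq; lra.
- rewrite complexReE E [complex.Im (- _)]complexReE iE complexReE [complex.Im (- ('i%C * q))]complexReE iq.
  lra.
- rewrite E cmodM cmod_real ger0_norm ?invr_ge0//.
  have : cmod (z - 'i%C * q) <= cmod z + cmod q.
    rewrite (le_trans (cmodB _ _))// lerD2l cmodM.
    by rewrite [cmod 'i%C](_ : _ = 1) ?mul1r// /cmod /= expr0n expr1n add0r sqrtr1.
  lra.
Qed.

(** The equation [z w = n Z w - (n - 1)] for [u = 1 / Z], with [n * e ^+ 2 = 1] and
    [w = u + e ^+ 2 * u ^+ 3 * J u]; the function [J] will be [gint mu e 2]. *)
Definition master z u := 1 + u ^+ 2 * J u - z * u * (1 + e%:C ^+ 2 * u ^+ 2 * J u).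

(** Divided difference of [u ^+ 3 * J u]. *)
Definition cubeD u v := (u ^+ 2 + u * v + v ^+ 2) * J u + v ^+ 3 * (e%:C * D u v).

(** What [master z u] adds to [1 + u ^+ 2 - z * u]; [pertD] is its divided difference in [u]. *)
Definition pert z u := u ^+ 2 * (J u - 1) - e%:C ^+ 2 * z * (u ^+ 3 * J u).

Definition pertD z u v :=
  (u + v) * (J u - 1) + v ^+ 2 * (e%:C * D u v) - e%:C ^+ 2 * z * cubeD u v.

Lemma cube_sub u v : cmod u <= 4 -> cmod v <= 4 ->
  u ^+ 3 * J u - v ^+ 3 * J v = (u - v) * cubeD u v.
Proof.
move=> u4 v4; have -> : J v = J u - e%:C * (u - v) * D u v.
  by rewrite -JD// opprB addrC subrK.
by rewrite /cubeD; ring.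
Qed.

Lemma pert_sub z u v : cmod u <= 4 -> cmod v <= 4 ->
  pert z u - pert z v = (u - v) * pertD z u v.
Proof.
move=> u4 v4; have JvE : J v = J u - e%:C * (u - v) * D u v.
  by rewrite -JD// opprB addrC subrK.
by rewrite /pert /pertD /cubeD JvE; ring.
Qed.

Let eD u v : cmod u <= 4 -> cmod v <= 4 -> cmod (e%:C * D u v) <= K * e.
Proof.
move=> u4 v4; rewrite cmodM cmod_real (gtr0_norm e0) mulrC.
by rewrite ler_wpM2r ?(ltW e0)// DK.
Qed.

Let e2 : e ^+ 2 <= K * e.
Proof. by rewrite expr2 (le_trans _ eKe)// ler_piMl// ltW. Qed.

Let e2C : cmod (e%:C ^+ 2) <= e ^+ 2.
Proof. by rewrite cmodX cmod_real gtr0_norm. Qed.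

Lemma cmod_cubeD u v : cmod u <= 4 -> cmod v <= 4 -> cmod (cubeD u v) <= 160.
Proof.
move=> u4 v4; have Ju := J2 u4.
have eD1 : cmod (e%:C * D u v) <= 1.
  by rewrite (le_trans (eD u4 v4))//; have := Ke; have := d1; lra.
rewrite /cubeD; set ed := e%:C * D u v in eD1 *.
apply: le_trans; first by cmod_bound.
by rewrite le_eqVlt; apply/orP; left; apply/eqP; ring.
Qed.

Lemma cmod_pertD z u v : cmod z <= 3 -> cmod u <= 4 -> cmod v <= 4 ->
  cmod (pertD z u v) <= s / 20.
Proof.
move=> z3 u4 v4; have Ju := J1 u4; have eD1 := eD u4 v4.
have cD := cmod_cubeD u4 v4; have e2C' := e2C.
rewrite /pertD; set ed := e%:C * D u v in eD1 *; set j := J u - 1 in Ju *.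
set cd := cubeD u v in cD *; set ee := e%:C ^+ 2 in e2C' *.
apply: le_trans; first by cmod_bound.
have e2' := e2; have Ke' := Ke; have s2' := s2; have s13' := s13; have s0' := s0; nra.
Qed.

Lemma cmod_pert z u : cmod z <= 3 -> cmod u <= 4 -> cmod (pert z u) <= delta / 12.
Proof.
move=> z3 u4; have Ju := J1 u4; have Ju2 := J2 u4.
have e2C' := e2C; rewrite /pert; set j := J u - 1 in Ju *.
set ee := e%:C ^+ 2 in e2C' *.
apply: le_trans; first by cmod_bound.
have e2' := e2; have Ke' := Ke; have := d0; lra.
Qed.

Let Im_le_cmod u : complex.Im u <= cmod u.
Proof. by rewrite (le_trans (ler_norm _))// normr_Im_le_cmod. Qed.

(** With [g = z - G] one has [1 + u ^+ 2 - z * u = (u - G) * (u - g)], so the equation reads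
    [u = G + pert z u / (g - u)]. On the disc of radius [s / 4] around [G] the imaginary parts keep
    [|g - u| >= s], and the right-hand side is a contraction. *)
Lemma master_exists z : wide_domain z ->
  exists2 u, cmod (u - G_omega z) <= s / 4 & master z u = 0.
Proof.
move=> Kz; have z3 := wide_domain_le3 Kz; have Gg := G_omega_root z.
have [iG ig G4] := G_omega_bounds Kz.
set G := G_omega z in Gg iG ig G4 *; set g := z - G in Gg ig *.
have u4 u : cmod (u - G) <= s / 4 -> cmod u <= 4.
  move=> uG; rewrite -(subrK G u) (le_trans (cmodD _ _))//.
  by have := s13; lra.
have gu u : cmod (u - G) <= s / 4 -> s <= cmod (g - u).
  move=> uG; apply: le_trans (Im_le_cmod _).
  have ImB (x y : C) : complex.Im (x - y) = complex.Im x - complex.Im y.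
    by rewrite !complexReE.
  rewrite (_ : g - u = g - (u - G) - G); last by ring.
  rewrite ImB [complex.Im (g - (u - G))]ImB.
  by have := le_trans (Im_le_cmod (u - G)) uG; have := s0; lra.
have gu0 u : cmod (u - G) <= s / 4 -> g - u != 0.
  by move=> /gu ?; rewrite -cmod_gt0 (lt_le_trans s0).
have inv_le u : cmod (u - G) <= s / 4 -> cmod (g - u)^-1 <= s^-1.
  by move=> /gu ?; rewrite cmodV lef_pV2 ?posrE// (lt_le_trans s0).
pose psi u := G + pert z u * (g - u)^-1.
have [|||u uG pu] := @contraction_fixpoint R psi G (s / 4).
- by rewrite divr_ge0 ?(ltW s0).
- move=> u uG; rewrite /psi addrC addKr cmodM.
  apply: (@le_trans _ _ (delta / 12 * s^-1)).
    by rewrite ler_pM ?cmod_ge0 ?cmod_pert ?u4 ?inv_le.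
  rewrite -s2 (_ : s ^+ 2 / 12 * s^-1 = s / 12); last by field; rewrite gt_eqF.
  by have := s0; lra.
- move=> u v uG vG; have := gu0 _ uG; have := gu0 _ vG => gv0 guN0.
  have -> : psi u - psi v =
      (u - v) * (pertD z u v * (g - u)^-1 + pert z v * ((g - u)^-1 * (g - v)^-1)).
    have E : pert z u = pert z v + (u - v) * pertD z u v.
      by rewrite -pert_sub ?u4// addrC subrK.
    by rewrite /psi E; field; apply/andP.
  rewrite cmodM mulrC ler_wpM2r ?cmod_ge0//.
  have hD := cmod_pertD z3 (u4 _ uG) (u4 _ vG); have hp := cmod_pert z3 (u4 _ vG).
  have hu := inv_le _ uG; have hv := inv_le _ vG.
  apply: le_trans; first by cmod_bound.
  rewrite -s2 (_ : s / 20 * s^-1 + s ^+ 2 / 12 * (s^-1 * s^-1) = 2 / 15); last by field; rewrite gt_eqF.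
  lra.
- exists u => //; have gN0 := gu0 _ uG.
  have E : (u - G) * (g - u) = pert z u.
    by rewrite -{1}pu /psi addrC addKr mulfVK.
  have -> : master z u = 1 + u ^+ 2 - z * u + pert z u by rewrite /master /pert; ring.
  by rewrite -E; transitivity (1 - G * g); [rewrite /g; ring|rewrite Gg subrr].
Qed.
(** The bound on [Im u] selects the root near [G_omega z]. It does not mention [z], so roots for
    different [z] can be compared. *)
Definition master_root z u :=
  [/\ master z u = 0, complex.Im u <= - (s / 2) & cmod u <= 4].

Lemma master_root_exists z : wide_domain z -> exists u, master_root z u.
Proof.
move=> Kz; have [u uG mu0] := master_exists Kz.
have [iG _ G4] := G_omega_bounds Kz; exists u; split => //.
- have := le_trans (Im_le_cmod (u - G_omega z)) uG.
  by rewrite complexReE [complex.Im (- _)]complexReE; have := s0; lra.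
- rewrite -(subrK (G_omega z) u) (le_trans (cmodD _ _))//.
  by have := s13; lra.
Qed.

(** Divided difference of [master z]. *)
Definition slope z u v := u + v - z + pertD z u v.

Lemma master_sub z z' u v : master_root z' u -> master_root z v ->
  (u - v) * slope z' u v = (z' - z) * (v * (1 + e%:C ^+ 2 * v ^+ 2 * J v)).
Proof.
move=> [mu0 _ u4] [mv0 _ v4].
have E x y : master y x = 1 + x ^+ 2 - y * x + pert y x.
  by rewrite /master /pert; ring.
have := pert_sub z' u4 v4; move: mu0 mv0; rewrite !E => mu0 mv0 pE.
have {}pE : pert z' u = pert z' v + (u - v) * pertD z' u v.
  by rewrite -pE addrC subrK.
apply/eqP; rewrite -subr_eq0; apply/eqP.
transitivity ((1 + u ^+ 2 - z' * u + pert z' u) - (1 + v ^+ 2 - z * v + pert z v)).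
  by rewrite pE /slope /pert; ring.
by rewrite mu0 mv0 subrr.
Qed.

(** [z - u - v] has imaginary part at least [s - s / 10], and [pertD] takes away at most
    [s / 20]. *)
Lemma slope_ge z u v : wide_domain z -> complex.Im u <= - (s / 2) ->
  complex.Im v <= - (s / 2) -> cmod u <= 4 -> cmod v <= 4 ->
  s / 2 <= cmod (slope z u v).
Proof.
move=> Kz iu iv u4 v4; have z3 := wide_domain_le3 Kz; case: Kz => _ iz.
have pD := cmod_pertD z3 u4 v4.
apply: le_trans (cmod_ge _ _); have := Im_le_cmod (- (u + v - z)).
rewrite cmodN (_ : complex.Im _ = complex.Im z - complex.Im u - complex.Im v); last first.
  by rewrite !complexReE; ring.
have : - (s / 10) <= complex.Im z.
  have : - complex.Im z <= `|complex.Im z| by rewrite -normrN ler_norm.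
  by have := ds; lra.
by have := s0; lra.
Qed.

Lemma slope_neq0 z u v : wide_domain z -> complex.Im u <= - (s / 2) ->
  complex.Im v <= - (s / 2) -> cmod u <= 4 -> cmod v <= 4 -> slope z u v != 0.
Proof.
move=> Kz iu iv u4 v4; rewrite -cmod_gt0.
by apply: lt_le_trans (slope_ge Kz iu iv u4 v4); rewrite divr_gt0.
Qed.

(** For [z = z'] this is uniqueness of the root. The constant is [132 / (s / 2)], with
    [132 = 4 * (1 + 4 ^+ 2 * 2)]. *)
Lemma master_root_lip z z' u v : wide_domain z' ->
  master_root z' u -> master_root z v -> cmod (u - v) <= 264 / s * cmod (z' - z).
Proof.
move=> Kz' ru rv; have E := master_sub ru rv.
case: ru rv => _ iu u4 [_ iv v4].
have sl := slope_ge Kz' iu iv u4 v4; have sl0 := slope_neq0 Kz' iu iv u4 v4.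
have b : cmod (v * (1 + e%:C ^+ 2 * v ^+ 2 * J v)) <= 132.
  have Jv := J2 v4; have eC := e1C.
  apply: le_trans; first by cmod_bound.
  lra.
have -> : u - v = (z' - z) * (v * (1 + e%:C ^+ 2 * v ^+ 2 * J v)) * (slope z' u v)^-1.
  by rewrite -E mulfK.
rewrite !cmodM cmodV -[X in X <= _]mulrA mulrC ler_wpM2r ?cmod_ge0//.
rewrite -cmodM (_ : 264 / s = 132 * (s / 2)^-1); last by field; rewrite gt_eqF.
by rewrite ler_pM ?cmod_ge0 ?invr_ge0 ?cmod_ge0// lef_pV2 ?posrE ?divr_gt0// cmod_gt0.
Qed.

(** On [wide_domain] the root exists and is unique, so the choice is immaterial and the default [0]
    is not taken. *)
Definition root_fun z : C := xget 0 [set u | master_root z u].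

Lemma root_funP z : wide_domain z -> master_root z (root_fun z).
Proof.
move=> /master_root_exists[u ru]; rewrite /root_fun.
by case: xgetP => [//|/(_ u)].
Qed.

(** The function [w] of [z], written in terms of [u = 1 / Z]. *)
Definition extension z : C := root_fun z + e%:C ^+ 2 * (root_fun z ^+ 3 * J (root_fun z)).

Lemma wide_domain_near z : wide_domain z ->
  exists2 r : R, 0 < r & forall w, cmod (w - z) < r -> wide_domain w.
Proof.
case=> rz iz.
exists (Num.min (2 - delta - `|complex.Re z|) (delta * s - `|complex.Im z|)).
  by rewrite lt_min !subr_gt0 rz.
move=> w; rewrite lt_min => /andP[w1 w2]; split; rewrite -(subrK z w) complexReE.
- rewrite (le_lt_trans (ler_normD _ _))// -ltrBrDr (le_lt_trans _ w1)//.
  exact: normr_Re_le_cmod.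
- rewrite (le_lt_trans (ler_normD _ _))// -ltrBrDr (le_lt_trans _ w2)//.
  exact: normr_Im_le_cmod.
Qed.

(** The formulas of [cubeD] and [slope] with the values of [J] and [D] as variables, so that
    continuity of the algebraic operations gives the limit. *)
Lemma tends0_ratio (u j d y : C -> C) (v jv dv z ee e' : C) :
  tends0 u v -> tends0 j jv -> tends0 d dv -> tends0 y z ->
  let cube w k q := (w ^+ 2 + w * v + v ^+ 2) * k + v ^+ 3 * (e' * q) in
  let slope w k q x := w + v - x +
    ((w + v) * (k - 1) + v ^+ 2 * (e' * q) - ee * x * cube w k q) in
  let num := v * (1 + ee * v ^+ 2 * jv) in
  slope v jv dv z != 0 ->
  tends0 (fun h => num * (slope (u h) (j h) (d h) (y h))^-1 *
            (1 + ee * cube (u h) (j h) (d h)))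
         (num * (slope v jv dv z)^-1 * (1 + ee * cube v jv dv)).
Proof.
move=> cu cj cd cy cube sl num sl0.
have ccube : tends0 (fun h => cube (u h) (j h) (d h)) (cube v jv dv).
  by rewrite /cube; tends0_tac.
have csl : tends0 (fun h => sl (u h) (j h) (d h) (y h)) (sl v jv dv z).
  by rewrite /sl; tends0_tac.
apply: tends0M; last by tends0_tac.
by apply: tends0M; [exact: tends0_cst|exact: tends0V].
Qed.

(** By [master_sub] and [cube_sub] the difference quotient equals [ratio h] exactly, and [ratio] has
    a limit because the root is Lipschitz in [z]. *)
Lemma derivable_extension z : wide_domain z ->
  derivable (extension : C^o -> C^o) (z : C^o) 1.
Proof.
move=> Kz; have [r r0 Kw] := wide_domain_near Kz.
have Kh h : cmod h < r -> wide_domain (h + z) by move=> hr; apply: Kw; rewrite addrK.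
pose v := root_fun z; have rv : master_root z v := root_funP Kz.
pose u h := root_fun (h + z).
have ru h : cmod h < r -> master_root (h + z) (u h) by move=> /Kh /root_funP.
have v4 : cmod v <= 4 by case: rv.
have u4 h : cmod h < r -> cmod (u h) <= 4 by move=> /ru[].
have u_lip h : cmod h < r -> cmod (u h - v) <= 264 / s * cmod h.
  by move=> hr; have := master_root_lip (Kh _ hr) (ru _ hr) rv; rewrite addrK.
have cu : tends0 u v.
  by apply: (tends0_cmod r0) => h _; exact: u_lip.
have cJ : tends0 (fun h => J (u h)) (J v).
  apply: (tends0_cmod (M := K * e * (264 / s)) r0) => h _ hr /=.
  rewrite JD ?u4// !cmodM cmod_real (gtr0_norm e0) mulrAC [e * _]mulrC -mulrA.
  apply: ler_pM; rewrite ?mulr_ge0 ?cmod_ge0 ?(ltW e0)// ?ler_wpM2r ?(ltW e0) ?DK ?u4//.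
  exact: u_lip.
have cD : tends0 (fun h => D (u h) v) (D v v).
  apply: (tends0_cmod (M := K * (264 / s)) r0) => h _ hr /=.
  rewrite (le_trans (DL _ _))// ?u4// -mulrA ler_wpM2l//; last exact: u_lip.
  exact: le_trans K1.
pose ratio h := v * (1 + e%:C ^+ 2 * v ^+ 2 * J v) * (slope (h + z) (u h) v)^-1 *
  (1 + e%:C ^+ 2 * cubeD (u h) v).
have ratioE h : h != 0 -> cmod h < r ->
    h^-1 * (extension (h + z) - extension z) = ratio h.
  move=> h0 hr; have [_ iu _] := ru _ hr; have [_ iv _] := rv.
  have sl0 := slope_neq0 (Kh _ hr) iu iv (u4 _ hr) v4.
  have E := master_sub (ru _ hr) rv; rewrite addrK in E.
  have uvE : u h - v = h * (v * (1 + e%:C ^+ 2 * v ^+ 2 * J v)) * (slope (h + z) (u h) v)^-1.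
    by rewrite -E mulfK.
  have -> : extension (h + z) - extension z = (u h - v) * (1 + e%:C ^+ 2 * cubeD (u h) v).
    have /= C3 := cube_sub (u4 _ hr) v4.
    transitivity (u h - v + e%:C ^+ 2 * (u h ^+ 3 * J (u h) - v ^+ 3 * J v)).
      by rewrite /extension -/(u h) -/v; ring.
    by rewrite C3; ring.
  by rewrite uvE /ratio; field; apply/andP.
have sl0 : slope z v v != 0.
  by case: rv => _ iv _; exact: slope_neq0.
have := tends0_ratio (ee := e%:C ^+ 2) (e' := e%:C) cu cJ cD (tends0_id z) sl0.
exact: (derivable_tends0 r0 ratioE).
Qed.

End PerturbedQuadratic.

(** * The asymptotic expansion and its stability *)

Section Expansion.
Variable R : realType.
Local Notation C := R[i].

(* [w] times the truncation of [K(w) - z], [K] being the functional inverse of the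
   Cauchy transform. *)
Definition trunc_master (k3 k4 k5 e z w : C) :=
  1 + w ^+ 2 + k3 * e * w ^+ 3 + k4 * e ^+ 2 * w ^+ 4 + k5 * e ^+ 3 * w ^+ 5 - z * w.

Definition trunc_slope (k3 k4 k5 e w t : C) :=
  k3 * (w ^+ 2 + w * t + t ^+ 2) +
  k4 * e * (w ^+ 3 + w ^+ 2 * t + w * t ^+ 2 + t ^+ 3) +
  k5 * e ^+ 2 * (w ^+ 4 + w ^+ 3 * t + w ^+ 2 * t ^+ 2 + w * t ^+ 3 + t ^+ 4).

Lemma trunc_master_sub k3 k4 k5 e z w t :
  trunc_master k3 k4 k5 e z w - trunc_master k3 k4 k5 e z t =
  (w - t) * (w + t - z + e * trunc_slope k3 k4 k5 e w t).
Proof. by rewrite /trunc_master /trunc_slope; ring. Qed.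

(** The equation gives [z w = 1 + u ^+ 2 * j]. Expanding in [e], the moments combine to cumulants
    and all orders below [e ^+ 4] cancel; [X] is the cofactor of [e ^+ 4]. *)
Lemma trunc_master_root (m3 m4 m5 : C) (K : R) : exists M, forall e z u j rho : C,
  cmod e <= 1 -> cmod u <= 4 -> cmod rho <= K ->
  j = 1 + e * m3 * u + e ^+ 2 * m4 * u ^+ 2 + e ^+ 3 * m5 * u ^+ 3 + e ^+ 4 * rho ->
  1 + u ^+ 2 * j - z * u * (1 + e ^+ 2 * u ^+ 2 * j) = 0 ->
  cmod (trunc_master m3 (m4 - 2) (m5 - 5 * m3) e z (u + e ^+ 2 * (u ^+ 3 * j)))
    <= M * cmod e ^+ 4.
Proof.
have c3 := lexx (cmod m3); have c4 := lexx (cmod m4); have c5 := lexx (cmod m5).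
(* The constant stays open until [cmod_bound] assembles it. *)
eexists => e z u j rho ee u4 rK jE ru.
set k4 := m4 - 2; set k5 := m5 - 5 * m3.
(* Tails of [j]: it equals [1 + e * j1] and [1 + e * m3 * u + e ^+ 2 * j2]. *)
pose j1 := m3 * u + e * m4 * u ^+ 2 + e ^+ 2 * m5 * u ^+ 3 + e ^+ 3 * rho.
pose j2 := m4 * u ^+ 2 + e * m5 * u ^+ 3 + e ^+ 2 * rho.
pose v := u ^+ 3 * j.
pose X := v ^+ 2 + m3 * e * (3 * u * v ^+ 2 + e ^+ 2 * v ^+ 3) +
  k4 * (4 * u ^+ 3 * v + 6 * e ^+ 2 * u ^+ 2 * v ^+ 2 + 4 * e ^+ 4 * u * v ^+ 3
        + e ^+ 6 * v ^+ 4) +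
  k5 * e * (5 * u ^+ 4 * v + 10 * e ^+ 2 * u ^+ 3 * v ^+ 2 +
    10 * e ^+ 4 * u ^+ 2 * v ^+ 3 + 5 * e ^+ 6 * u * v ^+ 4 + e ^+ 8 * v ^+ 5) +
  2 * u ^+ 4 * j2 + 3 * m3 * u ^+ 5 * j1 - u ^+ 2 * rho.
have -> : trunc_master m3 k4 k5 e z (u + e ^+ 2 * (u ^+ 3 * j)) = X * e ^+ 4.
  have zw : z * (u + e ^+ 2 * (u ^+ 3 * j)) = 1 + u ^+ 2 * j.
    by apply/esym/eqP; rewrite -subr_eq0 -ru; apply/eqP; ring.
  rewrite /trunc_master zw /X /v /j1 /j2 /k4 /k5 jE; ring.
rewrite cmodM cmodX ler_wpM2r ?exprn_ge0 ?cmod_ge0//.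
rewrite /X /v /j1 /j2 /k4 /k5 jE.
cmod_bound.
Qed.

(** The four equations annihilate the coefficients of [e ^+ 0] to [e ^+ 3]; [Y] is the cofactor of
    [e ^+ 4]. *)
Lemma trunc_master_expansion (k3 k4 k5 : C) (A : R) :
  exists M, forall e z G a1 a2 a3 : C,
  cmod e <= 1 -> cmod G <= 4 -> cmod a1 <= A -> cmod a2 <= A -> cmod a3 <= A ->
  1 + G ^+ 2 - z * G = 0 ->
  (2 * G - z) * a1 + k3 * G ^+ 3 = 0 ->
  (2 * G - z) * a2 + a1 ^+ 2 + 3 * k3 * G ^+ 2 * a1 + k4 * G ^+ 4 = 0 ->
  (2 * G - z) * a3 + 2 * a1 * a2 + k3 * (3 * G ^+ 2 * a2 + 3 * G * a1 ^+ 2) +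
    4 * k4 * G ^+ 3 * a1 + k5 * G ^+ 5 = 0 ->
  cmod (trunc_master k3 k4 k5 e z (G + e * a1 + e ^+ 2 * a2 + e ^+ 3 * a3))
    <= M * cmod e ^+ 4.
Proof.
have c3 := lexx (cmod k3); have c4 := lexx (cmod k4); have c5 := lexx (cmod k5).
eexists => e z G a1 a2 a3 ee G4 A1 A2 A3 E0 E1 E2 E3.
pose b := a2 + e * a3; pose a := a1 + e * a2 + e ^+ 2 * a3.
pose Y := 2 * a1 * a3 + b ^+ 2 + 3 * k3 * G ^+ 2 * a3 +
  3 * k3 * G * (2 * a1 * b + e * b ^+ 2) + k3 * a ^+ 3 +
  k4 * (4 * G ^+ 3 * b + 6 * G ^+ 2 * a ^+ 2 + 4 * G * e * a ^+ 3 + e ^+ 2 * a ^+ 4) +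
  k5 * (5 * G ^+ 4 * a + 10 * G ^+ 3 * e * a ^+ 2 + 10 * G ^+ 2 * e ^+ 2 * a ^+ 3 +
    5 * G * e ^+ 3 * a ^+ 4 + e ^+ 4 * a ^+ 5).
have -> : trunc_master k3 k4 k5 e z (G + e * a1 + e ^+ 2 * a2 + e ^+ 3 * a3) =
    Y * e ^+ 4.
  transitivity (Y * e ^+ 4 + (1 + G ^+ 2 - z * G) +
    e * ((2 * G - z) * a1 + k3 * G ^+ 3) +
    e ^+ 2 * ((2 * G - z) * a2 + a1 ^+ 2 + 3 * k3 * G ^+ 2 * a1 + k4 * G ^+ 4) +
    e ^+ 3 * ((2 * G - z) * a3 + 2 * a1 * a2 + k3 * (3 * G ^+ 2 * a2 + 3 * G * a1 ^+ 2) +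
      4 * k4 * G ^+ 3 * a1 + k5 * G ^+ 5)).
    by rewrite /trunc_master /Y /b /a; ring.
  by rewrite E0 E1 E2 E3 !mulr0 !addr0.
rewrite cmodM cmodX ler_wpM2r ?exprn_ge0 ?cmod_ge0//.
rewrite /Y /b /a.
cmod_bound.
Qed.

Definition coef1 (k3 G : C) := k3 * G ^+ 4 / (1 - G ^+ 2).

Definition coef2 (k3 k4 G : C) := (k4 - k3 ^+ 2) * (G ^+ 5 / (1 - G ^+ 2)) +
  k3 ^+ 2 * (G ^+ 7 / (1 - G ^+ 2) ^+ 2 + G ^+ 5 / (1 - G ^+ 2) ^+ 3).

Definition coef3 (k3 k4 k5 G : C) := k5 * G ^+ 6 / (1 - G ^+ 2)
  - k3 * k4 * G ^+ 8 * (5 * G ^+ 2 - 7) / (1 - G ^+ 2) ^+ 3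
  + k3 ^+ 3 * G ^+ 10 * (5 * G ^+ 4 - 15 * G ^+ 2 + 12) / (1 - G ^+ 2) ^+ 5.

Lemma coef_bound (k3 k4 k5 : C) (I : R) : exists A : R, forall G : C,
  cmod G <= 4 -> cmod (1 - G ^+ 2)^-1 <= I ->
  [/\ cmod (coef1 k3 G) <= A, cmod (coef2 k3 k4 G) <= A &
      cmod (coef3 k3 k4 k5 G) <= A].
Proof.
have c3 := lexx (cmod k3); have c4 := lexx (cmod k4); have c5 := lexx (cmod k5).
have [A1 H1] : exists A, forall G, cmod G <= 4 -> cmod (1 - G ^+ 2)^-1 <= I ->
    cmod (coef1 k3 G) <= A.
  by eexists => G G4; rewrite /coef1; set i := _^-1 => iI; cmod_bound.
have [A2 H2] : exists A, forall G, cmod G <= 4 -> cmod (1 - G ^+ 2)^-1 <= I ->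
    cmod (coef2 k3 k4 G) <= A.
  by eexists => G G4; rewrite /coef2 -!exprVn; set i := (1 - _)^-1 => iI; cmod_bound.
have [A3 H3] : exists A, forall G, cmod G <= 4 -> cmod (1 - G ^+ 2)^-1 <= I ->
    cmod (coef3 k3 k4 k5 G) <= A.
  by eexists => G G4; rewrite /coef3 -!exprVn; set i := (1 - _)^-1 => iI; cmod_bound.
exists (Num.max A1 (Num.max A2 A3)) => G G4 iI.
by rewrite !le_max H1// H2// H3// !orbT.
Qed.

(** After substituting [z = G + 1 / G] these are identities between rational functions of [G]. *)
Lemma coef_equations (k3 k4 k5 G z : C) : G * (z - G) = 1 -> 1 - G ^+ 2 != 0 ->
  let a1 := coef1 k3 G in let a2 := coef2 k3 k4 G in let a3 := coef3 k3 k4 k5 G in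
  [/\ (2 * G - z) * a1 + k3 * G ^+ 3 = 0,
      (2 * G - z) * a2 + a1 ^+ 2 + 3 * k3 * G ^+ 2 * a1 + k4 * G ^+ 4 = 0 &
      (2 * G - z) * a3 + 2 * a1 * a2 + k3 * (3 * G ^+ 2 * a2 + 3 * G * a1 ^+ 2) +
        4 * k4 * G ^+ 3 * a1 + k5 * G ^+ 5 = 0].
Proof.
move=> Gz G1; have G0 : G != 0 by apply: contra_eq_neq Gz => ->; rewrite mul0r eq_sym oner_eq0.
have -> : z = G + G^-1 by rewrite -[z in LHS](subrK G) addrC; congr (_ + _); apply: (mulfI G0); rewrite Gz mulfV.
by rewrite /coef1 /coef2 /coef3; split; field; rewrite G0 G1.
Qed.

Definition expansion (k3 k4 k5 e G : C) :=
  G + e * coef1 k3 G + e ^+ 2 * coef2 k3 k4 G + e ^+ 3 * coef3 k3 k4 k5 G.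

(** Both [w] and the expansion [t] make [trunc_master] of size [O(e ^+ 4)], and the difference of
    its values is [w - t] times a factor of modulus at least [s / 4], provided [e <= e0]. *)
Lemma expansion_bound (m3 m4 m5 K delta : R) : 0 < delta -> delta < 1 / 10 ->
  exists M, forall (e : R) (z u j rho : C), 0 < e -> e <= 1 ->
  wide_domain delta z -> cmod u <= 4 -> complex.Im u <= - (Num.sqrt delta / 2) ->
  cmod rho <= K -> cmod j <= 2 ->
  j = 1 + e%:C * m3%:C * u + e%:C ^+ 2 * m4%:C * u ^+ 2 +
      e%:C ^+ 3 * m5%:C * u ^+ 3 + e%:C ^+ 4 * rho ->
  1 + u ^+ 2 * j - z * u * (1 + e%:C ^+ 2 * u ^+ 2 * j) = 0 ->
  cmod (u + e%:C ^+ 2 * (u ^+ 3 * j) -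
    expansion m3%:C (m4%:C - 2) (m5%:C - 5 * m3%:C) e%:C (G_omega z)) <= M * e ^+ 4.
Proof.
move=> d0 d1; set s := Num.sqrt delta.
have s0 : 0 < s by rewrite sqrtr_gt0.
pose k3 := m3%:C; pose k4 := m4%:C - 2; pose k5 := m5%:C - 5 * m3%:C.
have [C1 HC1] := trunc_master_root m3%:C m4%:C m5%:C K.
(* [7 / s] bounds [1 / (1 - G ^+ 2) = (z - G) / (z - 2 * G)]. *)
have [A HA] := coef_bound k3 k4 k5 (7 * s^-1).
have [C2 HC2] := trunc_master_expansion k3 k4 k5 A.
have [CR HCR] : exists CR, forall e w t : C, cmod e <= 1 -> cmod w <= 132 ->
    cmod t <= 4 + 3 * A -> cmod (trunc_slope k3 k4 k5 e w t) <= CR.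
  have c3 := lexx (cmod k3); have c4 := lexx (cmod k4); have c5 := lexx (cmod k5).
  by eexists => e w t ee ww tt; rewrite /trunc_slope; cmod_bound.
(* For [e <= e0] the distances [128 * e] from [w] to [u] and [3 * A * e] from [t] to [G], together
   with the [trunc_slope] term, cost at most [s / 4]. *)
pose e0 := s / (512 + 12 * `|A| + 4 * `|CR|).
have den0 : 0 < 512 + 12 * `|A| + 4 * `|CR|.
  by have := normr_ge0 A; have := normr_ge0 CR; lra.
have e00 : 0 < e0 by rewrite divr_gt0.
(* The second summand covers [e > e0], where the trivial bound [132 + (4 + 3 * A)] on [w - t]
   suffices. *)
exists (4 / s * (`|C1| + `|C2|) + (136 + 3 * `|A|) / e0 ^+ 4).
move=> e z u j rho ep e1 Kz u4 iu rK j2 jE ru.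
rewrite /expansion -/k3 -/k4 -/k5; set G := G_omega z.
have Gz := G_omega_root z; have [iG ig G4] := G_omega_bounds d0 d1 Kz.
have z3 := wide_domain_le3 d0 d1 Kz.
rewrite -/G -/s in Gz iG ig G4.
have G4' : cmod G <= 4 by rewrite (le_trans G4)//; lra.
have eC : cmod e%:C <= 1 by rewrite cmod_real gtr0_norm.
have eN : cmod e%:C = e by rewrite cmod_real gtr0_norm.
have Im_le (x : C) : complex.Im x <= cmod x.
  by rewrite (le_trans (ler_norm _))// normr_Im_le_cmod.
have ImB (x y : C) : complex.Im (x - y) = complex.Im x - complex.Im y.
  by rewrite !complexReE.
have ImD (x y : C) : complex.Im (x + y) = complex.Im x + complex.Im y.
  by rewrite !complexReE.
have gG : s <= cmod (z - G - G).
  by apply: le_trans (Im_le _); rewrite ImB; lra.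
have gG0 : z - G - G != 0 by rewrite -cmod_gt0 (lt_le_trans s0).
have G0 : G != 0 by apply: contra_eq_neq Gz => ->; rewrite mul0r eq_sym oner_eq0.
have G1E : 1 - G ^+ 2 = G * (z - G - G) by rewrite mulrBr Gz.
have G10 : 1 - G ^+ 2 != 0 by rewrite G1E mulf_neq0.
have GI : cmod (1 - G ^+ 2)^-1 <= 7 * s^-1.
  have Gi : G^-1 = z - G by apply: (mulfI G0); rewrite Gz mulfV.
  rewrite G1E invfM cmodM Gi ler_pM ?cmod_ge0//.
    by rewrite (le_trans (cmodB _ _))//; lra.
  by rewrite cmodV lef_pV2 ?posrE// (lt_le_trans s0).
have [A1 A2 A3] := HA G G4' GI.
have [E1 E2 E3] := coef_equations k3 k4 k5 Gz G10.
have E0 : 1 + G ^+ 2 - z * G = 0 by rewrite -Gz; ring.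
set w := u + _; set t := G + _ + _ + _.
have Pw : cmod (trunc_master k3 k4 k5 e%:C z w) <= C1 * e ^+ 4.
  by have := HC1 _ z u j rho eC u4 rK jE ru; rewrite eN.
have Pt : cmod (trunc_master k3 k4 k5 e%:C z t) <= C2 * e ^+ 4.
  by have := HC2 _ z G _ _ _ eC G4' A1 A2 A3 E0 E1 E2 E3; rewrite eN.
have tG : cmod (t - G) <= e * (3 * A).
  have -> : t - G = e%:C * (coef1 k3 G + e%:C * coef2 k3 k4 G + e%:C ^+ 2 * coef3 k3 k4 k5 G).
    by rewrite /t; ring.
  rewrite cmodM eN ler_wpM2l ?(ltW ep)//.
  rewrite (_ : 3 * A = A + 1 * A + 1 ^+ 2 * A); last by ring.
  by cmod_bound.
have A0 : 0 <= A by rewrite (le_trans _ A1) ?cmod_ge0.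
have tM : cmod t <= 4 + 3 * A.
  rewrite -(subrK G t) addrC (le_trans (cmodD _ _))// lerD//.
  by rewrite (le_trans tG)// ler_piMl// mulr_ge0.
have wu : cmod (w - u) <= e * 128.
  have -> : w - u = e%:C * (e%:C * (u ^+ 3 * j)) by rewrite /w; ring.
  rewrite cmodM eN ler_wpM2l ?(ltW ep)//.
  rewrite (_ : 128 = 1 * (4 ^+ 3 * 2)); last by ring.
  by cmod_bound.
have wM : cmod w <= 132.
  rewrite -(subrK u w) (le_trans (cmodD _ _))//; lra.
have e4 : 0 <= e ^+ 4 by rewrite exprn_ge0// ltW.
have [ee0|e0e] := lerP e e0; last first.
  apply: (@le_trans _ _ (136 + 3 * `|A|)).
    by rewrite (le_trans (cmodB _ _))// ger0_norm//; lra.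
  rewrite [leRHS]mulrDl ler_wpDl//.
    by rewrite !mulr_ge0 ?addr_ge0// ?invr_ge0 ?ltW.
  rewrite -mulrA; apply: ler_peMr; first by rewrite addr_ge0// mulr_ge0.
  by rewrite mulrC ler_pdivlMr ?exprn_gt0// mul1r lerXn2r ?nnegrE ?(ltW e00) ?(ltW ep) ?(ltW e0e).
have CRb := HCR _ _ _ eC wM tM.
have dene : e * (512 + 12 * `|A| + 4 * `|CR|) <= s by rewrite -ler_pdivlMr.
have sl : s / 4 <= cmod (w + t - z + e%:C * trunc_slope k3 k4 k5 e%:C w t).
  apply: le_trans (cmod_ge _ _); rewrite cmodM eN.
  have := Im_le (- (w + t - z)); rewrite cmodN.
  have iwu := le_trans (Im_le (w - u)) wu; rewrite ImB in iwu.
  have itG := le_trans (Im_le (t - G)) tG; rewrite ImB in itG.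
  have -> : complex.Im (- (w + t - z)) = complex.Im z - complex.Im w - complex.Im t.
    by rewrite (_ : - (w + t - z) = z - w - t) ?ImB//; ring.
  have iz : - (s / 10) <= complex.Im z.
    have := Kz.2; rewrite -/s => izd; have : - complex.Im z <= `|complex.Im z| by rewrite -normrN ler_norm.
    have : delta * s <= s / 10 by rewrite mulrC ler_wpM2l ?(ltW s0)//; lra.
    lra.
  have eA : e * `|A| = e * A by rewrite ger0_norm.
  have eR : e * cmod (trunc_slope k3 k4 k5 e%:C w t) <= e * `|CR|.
    by rewrite ler_wpM2l ?(ltW ep)// (le_trans CRb)// ler_norm.
  have eCR : 0 <= e * `|CR| by rewrite mulr_ge0// ltW.
  have eA0 : 0 <= e * A by rewrite mulr_ge0// ltW.
  have : e * 512 + 12 * (e * A) + 4 * (e * `|CR|) <= s.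
    by apply: le_trans dene; rewrite -eA le_eqVlt; apply/orP; left; apply/eqP; ring.
  have s0' := s0; lra.
have sl0 : w + t - z + e%:C * trunc_slope k3 k4 k5 e%:C w t != 0.
  by rewrite -cmod_gt0; apply: lt_le_trans sl; rewrite divr_gt0.
have -> : w - t = (trunc_master k3 k4 k5 e%:C z w - trunc_master k3 k4 k5 e%:C z t) *
    (w + t - z + e%:C * trunc_slope k3 k4 k5 e%:C w t)^-1.
  by rewrite trunc_master_sub mulfK.
rewrite cmodM cmodV [leRHS]mulrDl ler_wpDr//.
  by rewrite mulr_ge0// divr_ge0 ?exprn_ge0 ?(ltW e00)// addr_ge0// mulr_ge0.
rewrite mulrC -[leRHS]mulrA ler_pM ?invr_ge0 ?cmod_ge0//.
  rewrite (_ : 4 / s = (s / 4)^-1); last by field; rewrite gt_eqF.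
  by rewrite lef_pV2 ?posrE ?divr_gt0// cmod_gt0.
rewrite (le_trans (cmodB _ _))// mulrDl lerD//.
  by rewrite (le_trans Pw)// ler_wpM2r// ler_norm.
by rewrite (le_trans Pt)// ler_wpM2r// ler_norm.
Qed.

End Expansion.

(** * Moments of a standardized measure *)

Section StandardizedMoments.
Variables (R : realType) (mu : probability (measurableTypeR R) R).

Lemma moment0 : moment mu 0 = 1.
Proof. exact: Rintegral_prob_cst. Qed.

Lemma moment1_centred : ('E_mu[fun x => x] = 0)%E -> moment mu 1 = 0.
Proof.
by rewrite unlock => E; rewrite /moment /Rintegral; under eq_integral do rewrite expr1; rewrite E.
Qed.

Lemma moment2_standard : ('E_mu[fun x => x] = 0)%E -> ('V_mu[fun x => x] = 1)%E ->
  moment mu 2 = 1.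
Proof.
move=> E0; rewrite /variance unlock E0 unlock => /(congr1 fine) /= <-.
rewrite /moment /Rintegral; congr fine; apply: eq_integral => x _.
by rewrite -[in RHS]/((x - 0) * (x - 0))%:E subr0.
Qed.

End StandardizedMoments.

(** * The hypotheses on [J] and [D] for a compactly supported law *)

Section Constants.
Variables (R : realType) (mu : probability (measurableTypeR R) R) (L e : R).
Local Notation C := R[i].
Hypotheses (muL : carried mu L) (L1 : 1 <= L) (e0 : 0 < e) (e1 : e <= 1).
Hypothesis eL : 8 * e * L <= 1.
Hypotheses (m1 : moment mu 1 = 0) (m2 : moment mu 2 = 1).

(** One constant for all the bounds, which come out as [16 * L ^+ 3], [8 * L ^+ 3] and
    [16 * L ^+ 4]. *)
Let K := 16 * L ^+ 4.

Let L34 : L ^+ 3 <= L ^+ 4. Proof. by rewrite [leRHS]exprS ler_peMl// exprn_ge0// (le_trans _ L1). Qed.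

Lemma K_ge1 : 1 <= K.
Proof. by have := exprn_ege1 4 L1; rewrite /K; lra. Qed.

Lemma gint_sub1_le u : cmod u <= 4 -> cmod (gint mu e 2 u - 1) <= K * e.
Proof.
move=> u4; rewrite (gint_rec muL L1 e0 eL)// m2 addrC addKr.
have := cmod_gint muL L1 e0 eL 3 u4.
rewrite !cmodM cmod_real (gtr0_norm e0) => g3.
apply: (@le_trans _ _ (e * 4 * (2 * (L ^+ 3 * 2)))).
  by rewrite ler_pM ?mulr_ge0 ?cmod_ge0 ?(ltW e0)// ler_wpM2l ?(ltW e0).
have e0' := e0; have L34' := L34; rewrite /K; nra.
Qed.

Lemma gint2_le u v : cmod u <= 4 -> cmod v <= 4 -> cmod (gint2 mu e 3 u v) <= K.
Proof.
move=> u4 v4; rewrite (le_trans (cmod_gint2 muL L1 e0 eL 3 u4 v4))//.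
have L34' := L34; have : 0 <= L ^+ 4 by rewrite exprn_ge0// (le_trans _ L1).
rewrite /K; lra.
Qed.

Lemma gint2_sub_le u v : cmod u <= 4 -> cmod v <= 4 ->
  cmod (gint2 mu e 3 u v - gint2 mu e 3 v v) <= K * cmod (u - v).
Proof.
move=> u4 v4; rewrite (le_trans (gint2_lip muL L1 e0 eL 3 v4 u4))//.
rewrite ler_wpM2r ?cmod_ge0//.
rewrite (_ : 2 * _ = K); last by rewrite /K; ring.
by rewrite ler_piMr// (le_trans _ K_ge1).
Qed.

Lemma gint_expansion u : cmod u <= 4 -> gint mu e 2 u =
  1 + e%:C * (moment mu 3)%:C * u + e%:C ^+ 2 * (moment mu 4)%:C * u ^+ 2 +
  e%:C ^+ 3 * (moment mu 5)%:C * u ^+ 3 + e%:C ^+ 4 * (u ^+ 4 * gint mu e 6 u).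
Proof.
by move=> u4; do 4 rewrite (gint_rec muL L1 e0 eL)//; rewrite m2; ring.
Qed.

Lemma gint_remainder_le u : cmod u <= 4 ->
  cmod (u ^+ 4 * gint mu e 6 u) <= 4 ^+ 4 * (2 * (L ^+ 6 * 2)).
Proof.
move=> u4; have g6 := cmod_gint muL L1 e0 eL 6 u4.
by apply: cmodM_le => //; exact: cmodX_le.
Qed.

(** Two steps of the moment recursion; the linear term vanishes because the mean is zero. *)
Lemma cint_resolvent u : u != 0 -> cmod u <= 4 ->
  cint mu (fun t => (u^-1 - (e * t)%:C)^-1) = u + e%:C ^+ 2 * (u ^+ 3 * gint mu e 2 u).
Proof.
move=> u0 u4; have -> : (fun t => (u^-1 - (e * t)%:C)^-1) = (fun t => u * (t%:C ^+ 0 * gker e u t)).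
    apply/funext => t; rewrite expr0 mul1r /gker.
    have -> : u^-1 - (e * t)%:C = u^-1 * (1 - (e * t)%:C * u).
      by rewrite mulrBr mulr1 mulrCA mulVf// mulr1.
    by rewrite invfM invrK.
rewrite cintZ; last first.
  apply: (carried_cintegrable muL (C := L ^+ 0 * 2)).
      by apply: cmeasM; [exact: cmeas_pow|exact: cmeas_gker].
    by move=> t tL; apply: cmodM_le; [exact: cmod_pow|exact: (cmod_gker e0 eL)].
rewrite -/(gint mu e 0 u) (gint_rec muL L1 e0 eL 0 u4) (gint_rec muL L1 e0 eL 1 u4).
by rewrite m1 moment0; ring.
Qed.

End Constants.

(** * From powers of [e] to powers of [n] *)

Section SquareRootForm.
Variable R : realType.

Lemma expansion_sqrt (k3 k4 k5 G : R[i]) n :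
  expansion k3 k4 k5 ((Num.sqrt n%:R)^-1)%:C G =
  G + k3 * G ^+ 4 / ((1 - G ^+ 2) * (Num.sqrt n%:R)%:C)
  + ((k4 - k3 ^+ 2) * (G ^+ 5 / (1 - G ^+ 2))
     + k3 ^+ 2 * (G ^+ 7 / (1 - G ^+ 2) ^+ 2 + G ^+ 5 / (1 - G ^+ 2) ^+ 3))
    * (1 / n%:R)
  + (k5 * G ^+ 6 / (1 - G ^+ 2)
     - k3 * k4 * G ^+ 8 * (5 * G ^+ 2 - 7) / (1 - G ^+ 2) ^+ 3
     + k3 ^+ 3 * G ^+ 10 * (5 * G ^+ 4 - 15 * G ^+ 2 + 12) / (1 - G ^+ 2) ^+ 5)
    * (1 / (n%:R `^ (3 / 2))%:C).
Proof.
set r := Num.sqrt (n%:R : R).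
have -> : n%:R = r%:C ^+ 2.
  by rewrite -rmorphXn sqr_sqrtr// rmorph_nat.
have -> : (n%:R : R) `^ (3 / 2) = r ^+ 3.
  by rewrite mulrC powRrM powR12_sqrt// powR_mulrn// sqrtr_ge0.
rewrite /expansion -/(coef2 k3 k4 G) -/(coef3 k3 k4 k5 G) fmorphV rmorphXn !div1r -!exprVn.
rewrite /coef1 invfM; congr (_ + _ + _ + _).
- by rewrite mulrC -!mulrA.
- by rewrite mulrC.
- by rewrite mulrC.
Qed.

End SquareRootForm.

(** Taking square roots in [a ^+ 2 * delta ^- 6 <= n] gives [a / sqrt n <= delta ^+ 3 <= delta]. *)
Lemma sqrt_nat_bounds (R : realType) (n : nat) (a delta : R) : 0 < a ->
  0 < delta -> delta < 1 -> a ^+ 2 * delta ^- 6 <= n%:R ->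
  [/\ (0 < n)%N, 0 < (Num.sqrt n%:R)^-1 :> R, a * (Num.sqrt n%:R)^-1 <= delta &
      n%:R * (Num.sqrt n%:R)^-1 ^+ 2 = 1 :> R].
Proof.
move=> a0 d0 d1 cn; have nR0 : 0 < n%:R :> R.
  by apply: lt_le_trans cn; rewrite divr_gt0// exprn_gt0.
have s0 : 0 < Num.sqrt n%:R :> R by rewrite sqrtr_gt0.
have s2 : Num.sqrt n%:R ^+ 2 = n%:R :> R by rewrite sqr_sqrtr.
split.
- by rewrite -(ltr_nat R).
- by rewrite invr_gt0.
- have le : a * delta ^- 3 <= Num.sqrt n%:R.
    rewrite -(ler_pXn2r (n := 2)) ?nnegrE ?mulr_ge0 ?invr_ge0 ?exprn_ge0 ?(ltW a0) ?(ltW d0) ?(ltW s0)//.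
    by rewrite s2 exprMn exprVn -exprM.
  rewrite ler_pdivrMr//; apply: (@le_trans _ _ (delta ^+ 3 * Num.sqrt n%:R)).
    by rewrite mulrC -ler_pdivrMr ?exprn_gt0.
  rewrite ler_wpM2r ?(ltW s0)// exprS ler_piMr ?(ltW d0)//.
  by rewrite exprn_ile1// ltW.
- by rewrite exprVn s2 mulfV// gt_eqF.
Qed.

(** * Choice of [c(mu)] and proof of analyticity, continuation and expansion *)

Theorem theorem2p2 (R : realType) (mu : probability (measurableTypeR R) R)
    (mean0 : ('E_mu[fun x => x] = 0)%E)
    (variance1 : ('V_mu[fun x => x] = 1)%E)
    (beta9 : (\int[mu]_x (`|x| ^+ 9)%:E < +oo)%E) :
  exists2 c : R, 0 < c &
  forall delta : R, 0 < delta -> delta < 1 / 10 ->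
  exists M : R,
  forall n : nat, c * delta ^- 6 <= n%:R ->
  msupp mu `<=` [set x | - (n%:R `^ (1 / 3)) <= x <= n%:R `^ (1 / 3)] ->
  forall mu_n : probability (measurableTypeR R) R,
  normalized_free_sum_law mu n mu_n ->
  exists F : R[i] -> R[i],
  [/\ holomorphic_on (rectK delta) F,
      forall z, rectK delta z -> 0 < complex.Im z ->
        F z = cauchy_transform mu_n z &
      forall z, rectK delta z ->
        let G := G_omega z in
        let k3 := (free_cumulant (moment mu) 3)%:C in
        let k4 := (free_cumulant (moment mu) 4)%:C in
        let k5 := (free_cumulant (moment mu) 5)%:C in
        `| F z -
           (G
            + k3 * G ^+ 4 / ((1 - G ^+ 2) * (Num.sqrt n%:R)%:C)
            + ((k4 - k3 ^+ 2) * (G ^+ 5 / (1 - G ^+ 2))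
               + k3 ^+ 2 * (G ^+ 7 / (1 - G ^+ 2) ^+ 2
                            + G ^+ 5 / (1 - G ^+ 2) ^+ 3))
              * (1 / n%:R)
            + (k5 * G ^+ 6 / (1 - G ^+ 2)
               - k3 * k4 * G ^+ 8 * (5 * G ^+ 2 - 7) / (1 - G ^+ 2) ^+ 3
               + k3 ^+ 3 * G ^+ 10 * (5 * G ^+ 4 - 15 * G ^+ 2 + 12)
                 / (1 - G ^+ 2) ^+ 5)
              * (1 / (n%:R `^ (3 / 2))%:C)) |
        <= (M / n%:R ^+ 2)%:C].
Proof.
(* [has_distribution] includes compact support, so in the other case no [mu_n] is given and any
   constants do. *)
have [cmu|ncmu] := pselect (compact (msupp mu)); last first.
  exists 1 => // delta _ _; exists 0 => n _ _ nu [A [X [_ momX _ _]]].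
  by case: ncmu; case: (momX 0).
have [L L1 muL] := compact_msupp_carried cmu.
have m0 := moment0 mu; have m1 := moment1_centred mean0.
have m2 := moment2_standard mean0 variance1.
pose K := 16 * L ^+ 4; have K1 : 1 <= K := K_ge1 L1.
(* The first summand yields [5000 * K * e <= delta], the second [8 * e * L <= 1]. *)
pose a := 5000 * K + 8 * L; have a0 : 0 < a by rewrite /a; lra.
exists (a ^+ 2); first by rewrite exprn_gt0.
move=> delta d0 d1.
have [M HM] := expansion_bound (moment mu 3) (moment mu 4) (moment mu 5)
  (4 ^+ 4 * (2 * (L ^+ 6 * 2))) d0 d1.
exists M => n cn _ nu nuP.
have d11 : delta < 1 by lra.
have [n0 e0 ae ne] := sqrt_nat_bounds a0 d0 d11 cn.
set e := (Num.sqrt n%:R)^-1 in e0 ae ne.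
have Ke0 : 0 <= K * e by rewrite mulr_ge0 ?(ltW e0)// (le_trans _ K1).
have Le0 : 0 <= L * e by rewrite mulr_ge0 ?(ltW e0)// (le_trans _ L1).
have small : 5000 * K * e <= delta by move: ae; rewrite /a mulrDl; lra.
have eL : 8 * e * L <= 1 by move: ae; rewrite /a mulrDl; lra.
have e1 : e <= 1.
  have : e <= K * e by rewrite ler_peMl// ltW.
  by move: small; lra.
have J1 := gint_sub1_le muL L1 e0 eL m2.
have JD u v (u4 : cmod u <= 4) (v4 : cmod v <= 4) := gintB muL L1 e0 eL 2 u4 v4.
have DK := gint2_le muL L1 e0 eL.
have DL := gint2_sub_le muL L1 e0 e1 eL.
pose J := gint mu e 2; pose F := extension e delta J.
have wide z : rectK delta z -> wide_domain delta z.
  case=> rz iz; split => //; rewrite (@le_lt_trans _ _ (2 - 2 * delta))//; last by lra.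
  by rewrite ler_norml; lra.
have root z : wide_domain delta z -> master_root e delta J z (root_fun e delta J z).
  exact: (root_funP K1 e0 d0 d1 small J1 JD DK).
exists F; split.
- move=> z /wide Kz; have [r r0 Kw] := wide_domain_near Kz.
  apply: (near_cmod r0) => w /Kw; exact: (derivable_extension K1 e0 d0 d1 small J1 JD DK DL).
(* As [u] lies in the lower half-plane, [Z = 1 / u] lies in the upper one, and [master z u = 0]
   turns into the subordination equation. *)
- move=> z /wide Kz z0; have [mu0 iu u4] := root z Kz.
  rewrite /F /extension; set u := root_fun _ _ _ z in mu0 iu u4 *.
  have iu0 : complex.Im u < 0.
    by apply: (le_lt_trans iu); rewrite oppr_lt0 divr_gt0// sqrtr_gt0.
  have u0 : u != 0 by apply: contraTneq iu0 => ->; rewrite ltxx.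
  have wE := cint_resolvent muL L1 e0 eL m1 u0 u4; rewrite -/J in wE.
  rewrite -wE; apply/esym/(cauchy_transform_normalized_free_sum nuP n0 _ z0).
    by rewrite complexReImV oppr_gt0 pmulr_llt0// invr_gt0 exprn_gt0// cmod_gt0.
  rewrite wE.
  have zw : z * (u + e%:C ^+ 2 * (u ^+ 3 * J u)) = 1 + u ^+ 2 * J u.
    by apply/esym/eqP; rewrite -subr_eq0 -mu0; apply/eqP; rewrite /master; ring.
  have neC : n%:R * e%:C ^+ 2 = 1 :> R[i].
    by rewrite -(rmorph_nat (real_complex R)) -rmorphXn -rmorphM ne.
  rewrite zw; transitivity (n%:R + n%:R * e%:C ^+ 2 * (u ^+ 2 * J u) - (n%:R - 1)).
    by rewrite neC; ring.
  by field.
- move=> z /wide Kz; cbv zeta; have [mu0 iu u4] := root z Kz.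
  set k3 := (free_cumulant _ 3)%:C; set k4 := (free_cumulant _ 4)%:C.
  set k5 := (free_cumulant _ 5)%:C.
  have k3E : k3 = (moment mu 3)%:C by rewrite /k3 free_cumulant3.
  have k4E : k4 = (moment mu 4)%:C - 2.
    by rewrite /k4 free_cumulant4// rmorphB rmorph_nat.
  have k5E : k5 = (moment mu 5)%:C - 5 * (moment mu 3)%:C.
    by rewrite /k5 free_cumulant5// rmorphB rmorphM rmorph_nat.
  rewrite -expansion_sqrt -/e cmodE lecR k3E k4E k5E.
  have -> : M / n%:R ^+ 2 = M * e ^+ 4.
    congr (_ * _); rewrite -[e ^+ 4]/(e ^+ (2 * 2)) exprM -exprVn; congr (_ ^+ 2).
    have nz : n%:R != 0 :> R by rewrite pnatr_eq0 -lt0n.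
    by apply: (mulfI nz); rewrite ne mulfV.
  have Ju := J1 _ u4; rewrite -/J -/K in Ju.
  have J2 : cmod (J (root_fun e delta J z)) <= 2.
    rewrite -[J _](subrK 1) (le_trans (cmodD _ _))// cmod1.
    by move: small d1; lra.
  exact: (HM e z _ _ _ e0 e1 Kz u4 iu (gint_remainder_le muL L1 e0 eL u4) J2
    (gint_expansion muL L1 e0 eL m2 u4) mu0).
Qed.
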